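(* Let $f\in X'$, $\nu>0$, $\hat\nu>0$, $\mu>0$, $H>0$, and let $u\in V$ be a weak solution of the steady Navier-Stokes equations with viscosity $\nu$ and forcing $f$. Set $$C_v := \left( \hat \nu^{-2} + \mu C_P^2 C_I^2 \nu^{-2}\hat \nu^{-1} \right)^{1/2} \| f \|_{-1}.$$ If $$H \leq \frac{\sqrt{2}\,\hat{\nu}^2}{\sqrt{27}\, C_I M^2 C_v^2}\qquad\text{and}\qquad \mu\ge \frac{\hat \nu}{2C_I^2 H^2},$$ then the CDA-NSE system: find $v\in V$ such that $$\hat \nu(\nabla v,\nabla \chi) + b(v,v,\chi) + \mu(I_H (v-u),I_H \chi)=\langle f,\chi \rangle\qquad \forall \chi\in V,$$ is well-posed; that is, a solution $v\in V$ exists, it is unique, and it depends continuously on the data in the sense of the a priori bound $\|\nabla v\|\le C_v$.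
   Context: $\Omega\subset\mathbb{R}^d$, $d\in\{2,3\}$, is open, connected and bounded, with either a $C^2$ boundary or being a convex polygon/polyhedron. $(\cdot,\cdot)$ and $\|\cdot\|$ are the $L^2(\Omega)$ inner product and norm. $X=(H_0^1(\Omega))^d$ with norm $\|\nabla\cdot\|$, $V=\{v\in X:\ \nabla\cdot v=0\}$, $X'$ is the dual of $X$ with dual norm $\|\cdot\|_{-1}$ and pairing $\langle\cdot,\cdot\rangle$. $C_P$ is the Poincaré constant: $\|\phi\|\le C_P\|\nabla\phi\|$ for all $\phi\in X$. Trilinear form: $b(u,v,w)=(u\cdot\nabla v,w)$. $M$ is a constant depending only on $\Omega$ such that for all $u,v,w\in X$: $b(u,v,w)\le M\|u\|^{1/2}\|\nabla u\|^{1/2}\|\nabla v\|\|\nabla w\|$, $b(u,v,w)\le M\|\nabla u\|\|\nabla v\|\|\nabla w\|$, and $b(u,v,w)\le M\|\nabla u\|\|\nabla v\|\|w\|^{1/2}\|\nabla w\|^{1/2}$. Weak solution $u$ of the steady Navier-Stokes equations with viscosity $\nu$ and forcing $f$ (no-slip boundary conditions): $u\in V$ with $\nu(\nabla u,\nabla\chi)+b(u,u,\chi)=\langle f,\chi\rangle$ for all $\chi\in V$. Such $u$ satisfies $\|\nabla u\|\le\nu^{-1}\|f\|_{-1}$. $I_H$ is a linear interpolation operator with characteristic point spacing $H>0$ and constant $C_I>0$ such that for all $\phi\in X$: $\|I_H\phi\|\le C_I\|\phi\|$ and $\|\phi-I_H\phi\|\le C_I H\|\nabla\phi\|$. Standing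 bound for $I_H$: for all $\phi\in X$, $\frac{\hat\nu}{2}\|\nabla\phi\|^2+\lambda\|\phi\|^2\le\hat\nu\|\nabla\phi\|^2+\mu\|I_H\phi\|^2$, where $\lambda=\min\{\mu,\frac{\hat\nu}{2C_I^2H^2}\}$. *)

(* Defs.v *)
From HB Require Import structures.
From mathcomp Require Import all_boot all_order all_algebra.
From mathcomp Require Import all_classical all_reals all_analysis.

Set Implicit Arguments.
Unset Strict Implicit.
Unset Printing Implicit Defensive.
Import Order.TTheory GRing.Theory Num.Theory.
Import numFieldNormedType.Exports.

Local Open Scope classical_set_scope.
Local Open Scope ring_scope.

Fact row_display : measure_display.
Proof. exact: default_measure_display. Qed.

(* 'rV[R]_n carries the product of the Borel sigma-algebras of its coordinates
   (as the library does for tuples), i.e. the Borel sigma-algebra of R^n. *)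
Section measurable_row.
Context (R : realType) (n : nat).

Definition row_coord (i : 'I_n) (x : 'rV[R]_n) : measurableTypeR R := x ord0 i.

Let row_set0 : g_sigma_preimage row_coord set0.
Proof. exact: sigma_algebra0. Qed.

Let row_setC A : g_sigma_preimage row_coord A -> g_sigma_preimage row_coord (~` A).
Proof. exact: sigma_algebraC. Qed.

Let row_bigcup (F : _^nat) : (forall i, g_sigma_preimage row_coord (F i)) ->
  g_sigma_preimage row_coord (\bigcup_i (F i)).
Proof. exact: sigma_algebra_bigcup. Qed.

HB.instance Definition _ :=
  @isMeasurable.Build row_display
    'rV[R]_n (g_sigma_preimage row_coord) row_set0 row_setC row_bigcup.

Lemma measurable_row_coord (i : 'I_n) : measurable_fun setT (row_coord i).
Proof.
move=> _ Y mY; rewrite setTI; apply: sub_sigma_algebra => /=.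
rewrite -bigcup_seq/=; exists i => /=; first by rewrite mem_index_enum.
by exists Y => //; rewrite setTI.
Qed.

Lemma measurable_to_row d (T : measurableType d) (f : T -> 'rV[R]_n) :
  (forall i, measurable_fun setT (row_coord i \o f)) -> measurable_fun setT f.
Proof.
move=> mf _ Y mY; rewrite setTI.
suff : g_sigma_preimage row_coord `<=` [set A | measurable (f @^-1` A)] by exact.
apply: smallest_sub.
  split; first by rewrite /= preimage_set0.
    by move=> A /= mA; rewrite setTD preimage_setC; exact: measurableC.
  by move=> F /= mF; rewrite preimage_bigcup; exact: bigcup_measurable.
move=> A; rewrite -bigcup_seq /= => -[i _ [B mB <-]] /=.
rewrite setTI -comp_preimage -[X in measurable X]setTI.
exact: mf.
Qed.

End measurable_row.

Definition row_cons (R : realType) (n : nat)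
    (p : measurableTypeR R * 'rV[R]_n) : 'rV[R]_n.+1 :=
  \row_j (if unlift ord0 j is Some k then p.2 ord0 k else p.1).

Lemma measurable_row_cons (R : realType) (n : nat) :
  measurable_fun setT (@row_cons R n).
Proof.
apply: measurable_to_row => i.
have [k ->|->] := unliftP ord0 i.
- rewrite (_ : _ \o _ = row_coord k \o snd); last first.
    by apply/funext => p; rewrite /= /row_coord mxE liftK.
  by apply: measurableT_comp; [exact: measurable_row_coord|exact: measurable_snd].
- rewrite (_ : _ \o _ = fst); first exact: measurable_fst.
  by apply/funext => p; rewrite /= /row_coord mxE unlift_none.
Qed.

Definition row_uncons (R : realType) (n : nat) (x : 'rV[R]_n.+1) :
    measurableTypeR R * 'rV[R]_n :=
  (x ord0 ord0, \row_k x ord0 (lift ord0 k)).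

Lemma measurable_row_uncons (R : realType) (n : nat) :
  measurable_fun setT (@row_uncons R n).
Proof.
apply/measurable_fun_pairP; split; first exact: (@measurable_row_coord R n.+1 ord0).
apply: measurable_to_row => i.
rewrite (_ : _ \o _ = row_coord (lift ord0 i)); first exact: measurable_row_coord.
by apply/funext => x; rewrite /= /row_coord mxE.
Qed.

Lemma row_consK (R : realType) (n : nat) : cancel (@row_cons R n) (@row_uncons R n).
Proof.
case=> a x; rewrite /row_uncons mxE unlift_none /=; congr pair.
by apply/rowP => k; rewrite !mxE liftK.
Qed.

Section row_measure.
Context (R : realType) (n : nat).
Variable m : {sigma_finite_measure set 'rV[R]_n -> \bar R}.

Definition row_measure : set 'rV[R]_n.+1 -> \bar R :=
  pushforward (@lebesgue_measure R \x m)%E (@row_cons R n).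


Let row_measure0 : row_measure set0 = 0%E.
Proof. by rewrite /row_measure /pushforward preimage_set0 measure0. Qed.

Let row_measure_ge0 A : (0 <= row_measure A)%E.
Proof. by rewrite /row_measure /pushforward measure_ge0. Qed.

Let row_measure_sigma_additive : semi_sigma_additive row_measure.
Proof.
move=> F mF tF mUF; rewrite /row_measure /pushforward preimage_bigcup.
apply: measure_semi_sigma_additive.
- by move=> k; rewrite -[X in measurable X]setTI; exact: measurable_row_cons.
- apply/trivIsetP => /= i j _ _ ij; rewrite -preimage_setI.
  by move/trivIsetP : tF => /(_ _ _ _ _ ij) ->//; rewrite preimage_set0.
- by rewrite -preimage_bigcup -[X in measurable X]setTI; exact: measurable_row_cons.
Qed.

HB.instance Definition _ := isMeasure.Build _ _ _ row_measure
  row_measure0 row_measure_ge0 row_measure_sigma_additive.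

Let row_measure_sigma_finite : sigma_finite setT row_measure.
Proof.
pose l : {sigma_finite_measure set (measurableTypeR R) -> \bar R} :=
  @lebesgue_measure R.
have /sigma_finiteP[F [TF ndF Foo]] := sigma_finiteT l.
have /sigma_finiteP[G [TG ndG Goo]] := sigma_finiteT m.
pose H k := F k `*` G k.
have HT : [set: measurableTypeR R * 'rV[R]_n] = \bigcup_k H k.
  rewrite -setXTT TF TG predeqE => -[x y]; split.
    move=> [/= [i _ Fnx] [k _ Gky]]; exists (maxn i k) => //; split.
    - by move: x Fnx; exact/subsetPset/ndF/leq_maxl.
    - by move: y Gky; exact/subsetPset/ndG/leq_maxr.
  by move=> [i _ []/= ? ?]; split; exists i.
have Hoo k : measurable (H k) /\ ((@lebesgue_measure R \x m) (H k) < +oo)%E.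
  have [? ?] := Foo k; have [? ?] := Goo k.
  split; first exact: measurableX.
  by rewrite product_measure1E// lte_mul_pinfty// ge0_fin_numE.
exists (fun k => @row_uncons R n @^-1` H k).
  by rewrite -preimage_bigcup -HT preimage_setT.
move=> k; have [mF Fk] := Hoo k; split.
  by rewrite -[X in measurable X]setTI; exact: measurable_row_uncons.
rewrite /row_measure /pushforward -comp_preimage.
by rewrite (_ : _ \o _ = id) //; apply/funext => p; exact: row_consK.
Qed.

HB.instance Definition _ := Measure_isSigmaFinite.Build _ _ _ row_measure
  row_measure_sigma_finite.

End row_measure.

(* Lebesgue measure on R^n, as the iterated product of the one on R. *)
Fixpoint lebesgue_row (R : realType) (n : nat) :
    {sigma_finite_measure set 'rV[R]_n -> \bar R} :=
  match n with
  | 0 => @dirac _ 'rV[R]_0 0 R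
  | n'.+1 => row_measure (lebesgue_row R n')
  end.

Section domains.
Context (R : realType) (d : nat).
Implicit Types (Om : set 'rV[R]_d).

(* For s = [:: i1; ...; ik] this is d_i1 ... d_ik phi. *)
Definition iter_partial n (phi : 'rV[R]_n -> R) (s : seq 'I_n) : 'rV[R]_n -> R :=
  foldr (fun i g x => 'D_'e_i g x) phi s.

Definition Ck_fun n (k : nat) (phi : 'rV[R]_n -> R) : Prop :=
  (forall s, (size s <= k)%N -> continuous (iter_partial phi s)) /\
  (forall s i x, (size s < k)%N -> derivable (iter_partial phi s) x 'e_i).

(* Locally, after singling out a coordinate axis i and an orientation b of it,
   Om is the set of points strictly above a C^2 graph. *)
Definition C2_boundary Om : Prop :=
  forall x0, closure Om x0 -> ~ Om° x0 ->
  exists (i : 'I_d) (b : bool) (g : 'rV[R]_d.-1 -> R),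
    Ck_fun 2 g /\
    \forall x \near x0, Om x <-> g (col' i x) < (-1) ^+ b * x ord0 i.

(* Meant for bounded open sets, for which it says "interior of a convex
   polytope". *)
Definition convex_polyhedral Om : Prop :=
  exists (m : nat) (a : 'I_m -> 'rV[R]_d) (c : 'I_m -> R),
    Om = [set x | forall k, \sum_(i < d) a k ord0 i * x ord0 i < c k].

Definition admissible_domain Om : Prop :=
  [/\ open Om, connected Om, bounded_set Om &
      C2_boundary Om \/ convex_polyhedral Om].

End domains.

(* Elements of L^2(Om) and H_0^1(Om) are represented by functions defined on
   all of R^d; only their restriction to Om matters, and equality of classes is
   almost everywhere equality on Om. *)
Section sobolev.
Context (R : realType) (d : nat) (Om : set 'rV[R]_d).
Implicit Types (phi p : 'rV[R]_d -> R) (g u v w : 'rV[R]_d -> 'rV[R]_d).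

Notation mu := (lebesgue_row R d).

Definition coord v (j : 'I_d) : 'rV[R]_d -> R := fun x => v x ord0 j.

Definition L2_fun p : Prop :=
  measurable_fun Om p /\ mu.-integrable Om (fun x => (p x ^+ 2)%:E).

Definition L2_field v : Prop := forall j, L2_fun (coord v j).

Definition test_fun phi : Prop :=
  (forall k, Ck_fun k phi) /\
  exists K, [/\ compact K, K `<=` Om & forall x, ~ K x -> phi x = 0].

Definition weak_gradient p g : Prop :=
  forall i phi, test_fun phi ->
    \int[mu]_(x in Om) (p x * 'D_'e_i phi x) =
    - \int[mu]_(x in Om) (g x ord0 i * phi x).

(* Squared H^1(Om) distance between p, with gradient g, and a test function. *)
Definition H1_sqdist p g phi : R :=
  \int[mu]_(x in Om) ((p x - phi x) ^+ 2) +
  \sum_(i < d) \int[mu]_(x in Om) ((g x ord0 i - 'D_'e_i phi x) ^+ 2).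

(* p is in H^1(Om), with weak gradient g, and in the H^1-closure of the test
   functions. *)
Definition H10_gradient p g : Prop :=
  [/\ L2_fun p, L2_field g, weak_gradient p g &
      forall e : R, 0 < e -> exists2 phi, test_fun phi & H1_sqdist p g phi < e].

Definition H10 p : Prop := exists g, H10_gradient p g.

(* The weak gradient is unique up to a null set; grad picks a representative. *)
Definition grad p : 'rV[R]_d -> 'rV[R]_d := xget (fun=> 0) (H10_gradient p).

Definition spaceX v : Prop := forall j, H10 (coord v j).

Definition partial v (i j : 'I_d) : 'rV[R]_d -> R :=
  fun x => grad (coord v j) x ord0 i.

Definition div v : 'rV[R]_d -> R := fun x => \sum_(i < d) partial v i i x.

Definition spaceV v : Prop := spaceX v /\ ae_eq mu Om (div v) (fun=> 0).

Definition ip v w : R :=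
  \int[mu]_(x in Om) (\sum_(j < d) v x ord0 j * w x ord0 j).

Definition L2norm v : R := Num.sqrt (ip v v).

Definition ip_grad v w : R :=
  \int[mu]_(x in Om) (\sum_(i < d) \sum_(j < d) partial v i j x * partial w i j x).

Definition norm_grad v : R := Num.sqrt (ip_grad v v).

(* (u . grad) v . w *)
Definition conv_density u v w : 'rV[R]_d -> R := fun x =>
  \sum_(j < d) (\sum_(i < d) u x ord0 i * partial v i j x) * w x ord0 j.

Definition bform u v w : R := \int[mu]_(x in Om) conv_density u v w x.

(* The integrability clause says that bform is well defined on X, which for
   d <= 3 is part of the classical estimates. *)
Definition trilinear_bounds (M : R) : Prop :=
  forall u v w, spaceX u -> spaceX v -> spaceX w ->
  [/\ mu.-integrable Om (EFin \o conv_density u v w),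
      bform u v w <= M * Num.sqrt (L2norm u) * Num.sqrt (norm_grad u) *
                 norm_grad v * norm_grad w,
      bform u v w <= M * norm_grad u * norm_grad v * norm_grad w &
      bform u v w <= M * norm_grad u * norm_grad v *
                 Num.sqrt (L2norm w) * Num.sqrt (norm_grad w)].

Definition poincare_constant (CP : R) : Prop :=
  forall v, spaceX v -> L2norm v <= CP * norm_grad v.

(* f v is the duality pairing; boundedness makes f independent of the chosen
   representative of v. *)
Definition dualX (f : ('rV[R]_d -> 'rV[R]_d) -> R) : Prop :=
  (forall (a : R) v w, spaceX v -> spaceX w ->
     f (fun x => a *: v x + w x) = a * f v + f w) /\
  exists C : R, forall v, spaceX v -> `|f v| <= C * norm_grad v.

Definition dual_norm (f : ('rV[R]_d -> 'rV[R]_d) -> R) : R :=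
  sup [set `|f v| / norm_grad v | v in [set v | spaceX v /\ norm_grad v != 0]].

Definition interpolation_operator
    (I : ('rV[R]_d -> 'rV[R]_d) -> 'rV[R]_d -> 'rV[R]_d) (H CI : R) : Prop :=
  [/\ forall v, spaceX v -> L2_field (I v),
      forall (a : R) v w, spaceX v -> spaceX w ->
        ae_eq mu Om (I (fun x => a *: v x + w x)) (fun x => a *: I v x + I w x),
      forall v, spaceX v -> L2norm (I v) <= CI * L2norm v &
      forall v, spaceX v -> L2norm (fun x => v x - I v x) <= CI * H * norm_grad v].

Definition interpolation_coercivity
    (I : ('rV[R]_d -> 'rV[R]_d) -> 'rV[R]_d -> 'rV[R]_d)
    (H CI nuh mu0 : R) : Prop :=
  forall v, spaceX v ->
    nuh / 2 * norm_grad v ^+ 2 +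
      Num.min mu0 (nuh / (2 * CI ^+ 2 * H ^+ 2)) * L2norm v ^+ 2
    <= nuh * norm_grad v ^+ 2 + mu0 * L2norm (I v) ^+ 2.

Definition NSE_weak_solution (nu : R) (f : ('rV[R]_d -> 'rV[R]_d) -> R) u : Prop :=
  spaceV u /\
  forall chi, spaceV chi -> nu * ip_grad u chi + bform u u chi = f chi.

Definition CDA_solution (nuh mu0 : R)
    (I : ('rV[R]_d -> 'rV[R]_d) -> 'rV[R]_d -> 'rV[R]_d)
    (f : ('rV[R]_d -> 'rV[R]_d) -> R) u v : Prop :=
  spaceV v /\
  forall chi, spaceV chi ->
    nuh * ip_grad v chi + bform v v chi + mu0 * ip (I (fun x => v x - u x)) (I chi)
    = f chi.

Definition Cv (nu nuh mu0 CP CI : R) (f : ('rV[R]_d -> 'rV[R]_d) -> R) : R :=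
  Num.sqrt (nuh ^- 2 + mu0 * CP ^+ 2 * CI ^+ 2 * nu ^- 2 * nuh^-1) * dual_norm f.

End sobolev.

(* Main.v *)
(* A solution v is a fixed point of the Picard map sending v to the solution v'
   of the linear problem nuh (grad v', grad chi) + b(v, v', chi) +
   mu (I v', I chi) = F(chi).  The linear problem is solvable by Lax-Milgram in
   the energy inner product nuh (grad v, grad w) + mu (I v, I w), because b(v, ., .)
   is skew-symmetric, and testing with v' gives |grad v'| <= Cv.  The coercivity of
   the nudging term, with lambda = nuh / (2 CI^2 H^2), controls |w| |grad w| by
   CI H / nuh times the squared energy of w, so the Picard map contracts the energy
   norm with squared rate CI H M^2 Cv^2 / nuh^2 <= sqrt (2/27) < 1.  Existence thus
   needs no compactness, and the same estimate gives uniqueness. *)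
Require Import Defs.
From mathcomp Require Import all_boot all_order all_algebra.
From mathcomp Require Import all_classical all_reals all_analysis.
From mathcomp Require Import measurable_realfun ring lra.
Import Order.TTheory GRing.Theory Num.Theory.
Import numFieldNormedType.Exports.
Set Implicit Arguments.
Unset Strict Implicit.
Unset Printing Implicit Defensive.
Local Open Scope classical_set_scope.
Local Open Scope ring_scope.

(** * Semi-inner products on subspaces *)

(** The trilinear hypotheses give integrability and one-sided bounds for [bform]; its skew-symmetry
    has to be proved. It is obtained first with test functions in the last two slots, then on all of
    [spaceX] by density, components being approximated one at a time. This, and already the fact
    that test functions lie in H_0^1 with their classical gradient, rests on one integration by
    parts: the integral of a partial derivative of a compactly supported function vanishes, by
    Fubini and the fundamental theorem of calculus along one axis. Fields are functions rather than
    classes, and [grad] picks a representative, so the forms are only semi-definite and are linear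
    only on a subset of the function space. Hilbert space theory is therefore developed relative to
    a subset [V], and its limits, Riesz vectors and fixed points are determined only up to null
    vectors. The completeness it requires of [spaceV] is built from that of L^2 through the
    closedness of the weak gradient. *)

Definition linear_set (R : realType) (E : lmodType R) (V : set E) : Prop :=
  V 0 /\ forall (k : R) x y, V x -> V y -> V (k *: x + y).

Definition linear_on (R : realType) (E : lmodType R) (V : set E) (F : E -> R) : Prop :=
  forall (k : R) x y, V x -> V y -> F (k *: x + y) = k * F x + F y.

(** Definiteness would fail in the intended examples: functions that differ on a null set are
    distinct elements at distance 0. Linearity is asked only on [V], because integrals are additive
    only on integrable functions. *)
Definition semi_inner (R : realType) (E : lmodType R) (V : set E)
    (a : E -> E -> R) : Prop :=
  [/\ forall z, V z -> linear_on V (a^~ z),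
      forall x y, V x -> V y -> a x y = a y x &
      forall x, V x -> 0 <= a x x].

Definition complete_for (R : realType) (E : lmodType R) (V : set E)
    (a : E -> E -> R) : Prop :=
  forall s : nat -> E, (forall n, V (s n)) ->
    (forall e : R, 0 < e -> exists N, forall m n, (N <= m)%N -> (N <= n)%N ->
       a (s m - s n) (s m - s n) < e) ->
  exists2 l, V l & forall e : R, 0 < e ->
    exists N, forall n, (N <= n)%N -> a (s n - l) (s n - l) < e.

Section linear_set.
Context {R : realType} {E : lmodType R} (V : set E).
Hypothesis hV : linear_set V.

Lemma linear_set0 : V 0. Proof. by case: hV. Qed.

Lemma linear_setD x y : V x -> V y -> V (x + y).
Proof. by move=> Vx Vy; rewrite -[x]scale1r; apply: hV.2. Qed.

Lemma linear_setZ (k : R) x : V x -> V (k *: x).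
Proof. by move=> Vx; rewrite -[_ *: _]addr0; apply: hV.2 => //; apply: hV.1. Qed.

Lemma linear_setB x y : V x -> V y -> V (x - y).
Proof.
by move=> Vx Vy; rewrite addrC -scaleN1r; apply: hV.2.
Qed.

Context (F : E -> R) (hF : linear_on V F).

Lemma linear_onD x y : V x -> V y -> F (x + y) = F x + F y.
Proof. by move=> Vx Vy; rewrite -[x]scale1r hF// scale1r mul1r. Qed.

Lemma linear_on0 : F 0 = 0.
Proof.
have := linear_onD linear_set0 linear_set0.
by rewrite addr0 => /(congr1 (fun z => z - F 0)); rewrite addrK subrr => <-.
Qed.

Lemma linear_onZ k x : V x -> F (k *: x) = k * F x.
Proof.
by move=> Vx; rewrite -[_ *: _]addr0 hF// ?linear_on0 ?addr0//; apply: linear_set0.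
Qed.

Lemma linear_onN x : V x -> F (- x) = - F x.
Proof. by move=> Vx; rewrite -scaleN1r linear_onZ// mulN1r. Qed.

Lemma linear_onB x y : V x -> V y -> F (x - y) = F x - F y.
Proof.
move=> Vx Vy; rewrite linear_onD// ?linear_onN// -scaleN1r; exact: linear_setZ.
Qed.

End linear_set.

Section semi_inner.
Context {R : realType} {E : lmodType R} (V : set E) (a : E -> E -> R).
Hypotheses (hV : linear_set V) (ha : semi_inner V a).

Let lin z : V z -> linear_on V (a^~ z). Proof. by case: ha => + _ _; apply. Qed.

Lemma semi_inner_sym x y : V x -> V y -> a x y = a y x.
Proof. by case: ha => _ + _; apply. Qed.

Lemma semi_inner_ge0 x : V x -> 0 <= a x x.
Proof. by case: ha => _ _; apply. Qed.

Let VD := linear_setD hV.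
Let VZ := linear_setZ hV.
Let VB := linear_setB hV.

Lemma semi_innerDl x y z : V x -> V y -> V z -> a (x + y) z = a x z + a y z.
Proof. by move=> Vx Vy Vz; rewrite (linear_onD (lin Vz)). Qed.

Lemma semi_innerZl k x z : V x -> V z -> a (k *: x) z = k * a x z.
Proof. by move=> Vx Vz; rewrite (linear_onZ hV (lin Vz)). Qed.

Lemma semi_innerBl x y z : V x -> V y -> V z -> a (x - y) z = a x z - a y z.
Proof. by move=> Vx Vy Vz; rewrite (linear_onB hV (lin Vz)). Qed.

Lemma semi_innerDr x y z : V x -> V y -> V z -> a z (x + y) = a z x + a z y.
Proof.
by move=> Vx Vy Vz; rewrite !(semi_inner_sym Vz)// ?semi_innerDl//; exact: VD.
Qed.

Lemma semi_innerZr k x z : V x -> V z -> a z (k *: x) = k * a z x.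
Proof.
by move=> Vx Vz; rewrite !(semi_inner_sym Vz)// ?semi_innerZl//; exact: VZ.
Qed.

Lemma semi_innerBr x y z : V x -> V y -> V z -> a z (x - y) = a z x - a z y.
Proof.
by move=> Vx Vy Vz; rewrite !(semi_inner_sym Vz)// ?semi_innerBl//; exact: VB.
Qed.

Lemma semi_inner_sqrD x y : V x -> V y ->
  a (x + y) (x + y) = a x x + 2 * a x y + a y y.
Proof.
move=> Vx Vy; have Vxy := VD Vx Vy.
by rewrite semi_innerDl// !semi_innerDr// (semi_inner_sym Vy Vx); ring.
Qed.

Lemma semi_inner_sqrB x y : V x -> V y ->
  a (x - y) (x - y) = a x x - 2 * a x y + a y y.
Proof.
move=> Vx Vy; have Vxy := VB Vx Vy.
by rewrite semi_innerBl// !semi_innerBr// (semi_inner_sym Vy Vx); ring.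
Qed.

Lemma semi_inner_sqrZ k x : V x -> a (k *: x) (k *: x) = k ^+ 2 * a x x.
Proof.
by move=> Vx; have Vk := @VZ k _ Vx; rewrite semi_innerZl// semi_innerZr//; ring.
Qed.

Lemma cauchy_schwarz x y : V x -> V y -> a x y ^+ 2 <= a x x * a y y.
Proof.
move=> Vx Vy; have x0 := semi_inner_ge0 Vx; have y0 := semi_inner_ge0 Vy.
have key t : 0 <= a x x - 2 * (t * a x y) + t ^+ 2 * a y y.
  have := semi_inner_ge0 (VB Vx (@VZ t _ Vy)).
  by rewrite (semi_inner_sqrB Vx (@VZ t _ Vy)) semi_innerZr// semi_inner_sqrZ.
have [yy|yy] := eqVneq (a y y) 0.
  have [->|xy] := eqVneq (a x y) 0; first by rewrite yy expr0n mulr0.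
  (* When [a y y = 0] the polynomial is affine in [t]; this value of [t] makes it [- a x x - 2],
     which is negative. *)
  exfalso; have := key ((a x x + 1) / a x y).
  by rewrite yy mulfVK//; lra.
have yp : 0 < a y y by rewrite lt_neqAle eq_sym yy.
have := key (a x y / a y y); rewrite -(pmulr_lge0 _ yp).
have -> : (a x x - 2 * (a x y / a y y * a x y) + (a x y / a y y) ^+ 2 * a y y) *
   a y y = a x x * a y y - a x y ^+ 2 by field.
by rewrite subr_ge0.
Qed.

Definition semi_norm x := Num.sqrt (a x x).
Local Notation N := semi_norm.

Lemma semi_norm_ge0 x : 0 <= N x. Proof. exact: sqrtr_ge0. Qed.

Lemma sqr_semi_norm x : V x -> N x ^+ 2 = a x x.
Proof. by move=> Vx; rewrite sqr_sqrtr// semi_inner_ge0. Qed.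

Lemma cauchy_schwarz_norm x y : V x -> V y -> `|a x y| <= N x * N y.
Proof.
move=> Vx Vy; rewrite -(@ler_pXn2r _ 2) ?nnegrE ?mulr_ge0 ?semi_norm_ge0//.
by rewrite exprMn !sqr_semi_norm// real_normK ?num_real// cauchy_schwarz.
Qed.

Lemma semi_normD x y : V x -> V y -> N (x + y) <= N x + N y.
Proof.
move=> Vx Vy; rewrite -(@ler_pXn2r _ 2) ?nnegrE ?addr_ge0 ?semi_norm_ge0//.
rewrite sqr_semi_norm ?semi_inner_sqrD//; last exact: VD.
rewrite -!sqr_semi_norm//.
have := le_trans (ler_norm _) (cauchy_schwarz_norm Vx Vy); lra.
Qed.

Lemma semi_normZ k x : V x -> N (k *: x) = `|k| * N x.
Proof.
by move=> Vx; rewrite /N semi_inner_sqrZ// sqrtrM ?sqr_ge0// sqrtr_sqr.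
Qed.

Lemma semi_normN x : V x -> N (- x) = N x.
Proof. by move=> Vx; rewrite -scaleN1r semi_normZ// normrN1 mul1r. Qed.

Lemma semi_norm_dist_sym x y : V x -> V y -> N (x - y) = N (y - x).
Proof. by move=> Vx Vy; rewrite -opprB semi_normN//; exact: VB. Qed.

Lemma semi_norm_dist x y z : V x -> V y -> V z -> N (x - z) <= N (x - y) + N (y - z).
Proof.
move=> Vx Vy Vz; rewrite (_ : x - z = (x - y) + (y - z)); last by rewrite addrA subrK.
by apply: semi_normD; exact: VB.
Qed.

Lemma semi_norm0 : N 0 = 0.
Proof. by rewrite -(scale0r 0) semi_normZ ?normr0 ?mul0r//; exact: linear_set0. Qed.

Lemma semi_inner_null x y : V x -> V y -> N x = 0 -> a x y = 0.
Proof.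
move=> Vx Vy Nx; apply/eqP; rewrite -normr_le0.
by apply: le_trans (cauchy_schwarz_norm Vx Vy) _; rewrite Nx mul0r.
Qed.

Hypothesis ca : complete_for V a.

Lemma semi_inner_complete (s : nat -> E) : (forall n, V (s n)) ->
  (forall e : R, 0 < e -> exists M, forall m n, (M <= m)%N -> (M <= n)%N ->
       N (s m - s n) < e) ->
  exists2 l, V l & forall e : R, 0 < e ->
    exists M, forall n, (M <= n)%N -> N (s n - l) < e.
Proof.
move=> Vs sN; have [|l Vl ls] := ca Vs.
  move=> e e0; have [|M sM] := sN (Num.sqrt e); first by rewrite sqrtr_gt0.
  exists M => m n Mm Mn; have := sM _ _ Mm Mn.
  by rewrite /N ltr_sqrt.
exists l => // e e0; have [|M sM] := ls (e ^+ 2); first by rewrite exprn_gt0.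
exists M => n Mn; have := sM _ Mn.
by rewrite -ltr_sqrt ?exprn_gt0// sqrtr_sqr gtr0_norm.
Qed.

(** Banach's theorem for a seminorm. The limit of the iterates from 0 is fixed up to a null vector,
    which is all that a seminorm can detect. *)
Lemma contraction_fixpoint (T : E -> E) (q : R) : 0 <= q -> q < 1 ->
  (forall x, V x -> V (T x)) ->
  (forall x y, V x -> V y -> N (T x - T y) <= q * N (x - y)) ->
  exists2 x, V x & N (T x - x) = 0.
Proof.
move=> q0 q1 VT Tq; pose s n := iter n T 0; pose c := N (T 0).
have Vs n : V (s n) by elim: n => [|n]; [exact: linear_set0|exact: VT].
have c0 : 0 <= c by exact: semi_norm_ge0.
have d0 : 0 < 1 - q by rewrite subr_gt0.
have Ss n : s n.+1 = T (s n) by [].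
have step n : N (s n.+1 - s n) <= q ^+ n * c.
  elim: n => [|n IH]; first by rewrite expr0 mul1r /s /= subr0.
  by apply: (le_trans (Tq _ _ (Vs n.+1) (Vs n))); rewrite exprS -mulrA ler_wpM2l.
have dist n j : N (s (n + j)%N - s n) <= q ^+ n * (c / (1 - q)).
  (* With the factor [1 - q ^+ j] the bound is an exact partial geometric sum, so the induction on
     [j] closes with an equality. *)
  suff : N (s (n + j)%N - s n) <= q ^+ n * (c / (1 - q)) * (1 - q ^+ j).
    move=> /le_trans; apply; rewrite ler_piMr//.
      by rewrite mulr_ge0 ?exprn_ge0// divr_ge0// ltW.
    by rewrite gerBl exprn_ge0.
  elim: j => [|j IH]; first by rewrite addn0 subrr semi_norm0 expr0 subrr mulr0.
  apply: le_trans (semi_norm_dist (Vs _) (Vs (n + j)%N) (Vs _)) _.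
  rewrite addnS; apply: le_trans (lerD (step _) IH) _.
  rewrite exprD exprS le_eqVlt; apply/orP; left; apply/eqP.
  by field; rewrite gt_eqF.
have qn (e : R) : 0 < e -> exists M, forall n, (M <= n)%N -> q ^+ n * (c / (1 - q)) < e.
  move=> e0; have : (fun n => q ^+ n * (c / (1 - q))) @ \oo --> (0 : R).
    rewrite -[X in _ --> X](mul0r (c / (1 - q))); apply: cvgMl.
    by apply: cvg_expr; rewrite ger0_norm.
  move=> /cvgrPdist_lt /(_ _ e0) [M _ HM]; exists M => n Mn.
  have := HM _ Mn; rewrite sub0r normrN => /le_lt_trans; apply; exact: ler_norm.
have dist2 m n M : (M <= m)%N -> (M <= n)%N ->
    N (s m - s n) <= 2 * (q ^+ M * (c / (1 - q))).
  move=> Mm Mn; apply: le_trans (semi_norm_dist (Vs _) (Vs M) (Vs _)) _.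
  rewrite (semi_norm_dist_sym (Vs M) (Vs n)).
  have := dist M (m - M)%N; have := dist M (n - M)%N; rewrite !subnKC//; lra.
have [e e0|l Vl sl] := semi_inner_complete Vs.
  have [|M HM] := qn (e / 2); first by rewrite divr_gt0.
  exists M => m n Mm Mn; have := dist2 _ _ _ Mm Mn; have := HM M (leqnn _); lra.
exists l => //; apply/eqP; rewrite eq_le semi_norm_ge0 andbT.
apply/ler_addgt0Pl => e e0; rewrite addr0.
have [|M HM] := sl (e / 2); first by rewrite divr_gt0.
have := semi_norm_dist (VT _ Vl) (Vs M.+1) Vl.
have := HM _ (leqnn _); have := HM _ (leqnSn M).
rewrite (semi_norm_dist_sym (VT _ Vl) (Vs M.+1)).
have := Tq _ _ (Vs M) Vl; have := semi_norm_ge0 (s M - l).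
by rewrite Ss; nra.
Qed.

(** The representing vector minimizes the quadratic functional [J]. Boundedness of [F] makes [J]
    bounded below, the parallelogram identity makes minimizing sequences Cauchy, and the Euler
    equation at the minimizer is [a z x = F x]. *)
Lemma riesz_representation (F : E -> R) (C : R) : linear_on V F ->
  (forall x, V x -> `|F x| <= C * N x) ->
  exists2 z, V z & forall x, V x -> a z x = F x.
Proof.
move=> linF FC.
pose J x := a x x - 2 * F x.
have FC' x : V x -> F x <= `|C| * N x.
  move=> Vx; apply: le_trans (ler_norm _) (le_trans (FC _ Vx) _).
  by rewrite ler_wpM2r ?semi_norm_ge0 ?ler_norm.
have Jlb x : V x -> - `|C| ^+ 2 <= J x.
  move=> Vx; rewrite /J -sqr_semi_norm//; have := FC' x Vx.
  have := sqr_ge0 (N x - `|C|); rewrite sqrrB; nra.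
pose S := [set J x | x in V].
have infS : has_inf S.
  split; first by exists (J 0), 0 => //; exact: linear_set0.
  by exists (- `|C| ^+ 2) => _ [x Vx <-]; exact: Jlb.
have Jinf x : V x -> inf S <= J x.
  by move=> Vx; apply: ge_inf; [case: infS | exists x].
have ex n : exists x, V x /\ J x < inf S + n.+1%:R^-1.
  have [|_ [x Vx <-] Jx] := @inf_adherent _ S (n.+1%:R^-1) _ infS.
    by rewrite invr_gt0.
  by exists x.
have [s Hs] := choice ex.
have Vs n : V (s n) by case: (Hs n).
have JD x t y : V x -> V y ->
    J (x + t *: y) = J x + 2 * t * (a x y - F y) + t ^+ 2 * a y y.
  move=> Vx Vy; have Vty := @VZ t _ Vy; rewrite /J semi_inner_sqrD// semi_innerZr//.
  by rewrite semi_inner_sqrZ// (linear_onD linF)// (linear_onZ hV linF)//; ring.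
have invn (e : R) : 0 < e -> exists M, forall n, (M <= n)%N -> n.+1%:R^-1 < e.
  move=> e0; have := @cvg_harmonic R; move=> /cvgrPdist_lt /(_ _ e0) [M _ HM].
  exists M => n Mn; have := HM _ Mn; rewrite sub0r normrN => /le_lt_trans; apply.
  exact: ler_norm.
(* At the midpoint, [J] is the mean of [J (s m)] and [J (s n)] minus a quarter of the squared
   distance, and it is still at least [inf S]. *)
have par m n : a (s m - s n) (s m - s n) <= 2 * m.+1%:R^-1 + 2 * n.+1%:R^-1.
  have [Vm Jm] := Hs m; have [Vn Jn] := Hs n.
  have := Jinf _ (VD Vm (@VZ (2^-1) _ (VB Vn Vm))); rewrite JD//; last exact: VB.
  rewrite semi_innerBr// (linear_onB hV linF)// !semi_inner_sqrB//.
  rewrite (semi_inner_sym Vn Vm); move: Jm Jn; rewrite /J.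
  by move: (m.+1%:R^-1) (n.+1%:R^-1) => p1 p2; lra.
have [e e0|z Vz sz] := ca Vs.
  have [|M HM] := invn (e / 4); first by rewrite divr_gt0.
  exists M => m n Mm Mn; have := par m n; have := HM _ Mm; have := HM _ Mn.
  by move: (m.+1%:R^-1) (n.+1%:R^-1) => p1 p2; lra.
exists z => // x Vx; apply/eqP; rewrite -subr_eq0 -normr_le0.
apply/ler_addgt0Pl => e e0; rewrite addr0.
have ax0 := semi_inner_ge0 Vx.
(* J (s n) is within 1/(n+1) of its infimum, so its slope D along x at s n satisfies
   D^2 <= c / (n+1); the step - D / c exhibits this. *)
have near (e1 : R) : 0 < e1 -> exists n, `|a (s n) x - F x| <= e1 /\ N (s n - z) <= e1.
  move=> e10; pose c := a x x + 1; have c0 : 0 < c by rewrite /c; lra.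
  have [|M1 HM1] := invn (e1 ^+ 2 / c).
    by rewrite divr_gt0// exprn_gt0.
  have [|M2 HM2] := sz (e1 ^+ 2); first by rewrite exprn_gt0.
  exists (maxn M1 M2); set n := maxn _ _.
  have := HM1 n (leq_maxl _ _); have := HM2 n (leq_maxr _ _) => h2 h1.
  split; last first.
    by rewrite -(@ler_pXn2r _ 2) ?nnegrE ?semi_norm_ge0 ?ltW// sqr_semi_norm//; exact: VB.
  have [_ Jn] := Hs n; set D := a (s n) x - F x.
  have := Jinf _ (VD (Vs n) (@VZ (- D / c) _ Vx)); rewrite JD// -/D => Jx.
  have : D ^+ 2 / c <= n.+1%:R^-1.
    have -> : D ^+ 2 / c = - (2 * (- D / c) * D + (- D / c) ^+ 2 * c).
      by field; rewrite gt_eqF.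
    have : (- D / c) ^+ 2 * a x x <= (- D / c) ^+ 2 * c.
      by rewrite ler_wpM2l ?sqr_ge0// /c lerDl.
    move: Jx Jn; move: (n.+1%:R^-1) (- D / c) => p t.
    by clear; move: (J _) (inf S) c => j i c; lra.
  move=> /le_lt_trans /(_ h1); rewrite ltr_pM2r ?invr_gt0// => /ltW h.
  rewrite -(@ler_pXn2r _ 2) ?nnegrE ?(ltW e10)//. by rewrite real_normK ?num_real.
have [|n [h1 h2]] := near (e / (1 + N x)).
  by rewrite divr_gt0// ltr_pwDl ?semi_norm_ge0.
have -> : a z x - F x = (a (s n) x - F x) - a (s n - z) x.
  by rewrite semi_innerBl//; ring.
apply: le_trans (ler_normB _ _) _.
have := cauchy_schwarz_norm (VB (Vs n) Vz) Vx.
have p : 0 < 1 + N x by rewrite ltr_pwDl ?semi_norm_ge0.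
have : N (s n - z) * N x <= e / (1 + N x) * N x by rewrite ler_wpM2r ?semi_norm_ge0.
have : e / (1 + N x) + e / (1 + N x) * N x = e by field; rewrite gt_eqF.
by move: h1; lra.
Qed.

(** Riesz turns [t] into an operator [S] and [F] into a vector [g]. The equation becomes
    [w + S w = g] modulo null vectors, and is solved by the damped iteration [T]; skewness of [t] is
    what makes a suitable damping contract. *)
Lemma lax_milgram_skew (t : E -> E -> R) (K C : R) (F : E -> R) :
  (forall z, V z -> linear_on V (t^~ z)) -> (forall z, V z -> linear_on V (t z)) ->
  (forall x y, V x -> V y -> `|t x y| <= K * N x * N y) ->
  (forall x, V x -> t x x = 0) ->
  linear_on V F -> (forall x, V x -> `|F x| <= C * N x) ->
  exists2 w, V w & forall x, V x -> a w x + t w x = F x.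
Proof.
move=> tl tr tK t0 Fl FC.
(* [choice] asks for a value at every [x], so the property is conditional on [V x], with 0 as
   default outside [V]. *)
have exS x : exists z, V x -> V z /\ forall y, V y -> a z y = t x y.
  have [Vx|nVx] := pselect (V x); last by exists 0.
  have [|z Vz zt] := riesz_representation (tr x Vx) (C := K * N x); first by move=> y Vy; exact: tK.
  by exists z.
have [S HS] := choice exS.
have [g Vg gF] := riesz_representation Fl FC.
have VS x : V x -> V (S x) by move=> /HS[].
have St x y : V x -> V y -> a (S x) y = t x y by move=> /HS[_]; apply.
pose L := `|K| + 1.
have L1 : 0 < L by rewrite /L ltr_wpDl.
(* The values of [S] are chosen separately, so [S] is linear only modulo null vectors; boundedness
   and skewness are therefore stated for differences [S x - S y]. *)
have NS x y : V x -> V y -> a (S x - S y) (S x - S y) <= L ^+ 2 * a (x - y) (x - y).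
  move=> Vx Vy; have VSS := VB (VS _ Vx) (VS _ Vy); have Vxy := VB Vx Vy.
  have : a (S x - S y) (S x - S y) = t (x - y) (S x - S y).
    by rewrite (semi_innerBl (VS _ Vx) (VS _ Vy) VSS) !St// (linear_onB hV (tl _ VSS)).
  have := le_trans (ler_norm _) (tK _ _ Vxy VSS).
  rewrite -!sqr_semi_norm//; set n1 := N (x - y); set n2 := N _ => h e.
  have n10 : 0 <= n1 by exact: semi_norm_ge0.
  have n20 : 0 <= n2 by exact: semi_norm_ge0.
  have h' : n2 * n2 <= L * n1 * n2.
    rewrite -expr2 e; apply: le_trans h _.
    by rewrite !ler_wpM2r// /L; have := ler_norm K; lra.
  rewrite -exprMn ler_pXn2r ?nnegrE ?mulr_ge0 ?(ltW L1)//.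
  have [->|n2n] := eqVneq n2 0; first by rewrite mulr_ge0// ltW.
  by move: h'; rewrite ler_pM2r// lt_neqAle eq_sym n2n.
have SB x y : V x -> V y -> a (x - y) (S x - S y) = 0.
  move=> Vx Vy; have VSS := VB (VS _ Vx) (VS _ Vy); have Vxy := VB Vx Vy.
  rewrite semi_inner_sym// (semi_innerBl (VS _ Vx) (VS _ Vy) Vxy) !St//.
  by rewrite -(linear_onB hV (tl _ Vxy))// t0.
(* As S is skew, |x - rho (x + S x)|^2 = (1 - rho)^2 |x|^2 + rho^2 |S x|^2, and
   this rho minimizes (1 - rho)^2 + rho^2 L^2. *)
pose rho := (1 + L ^+ 2)^-1.
have rp : 0 < 1 + L ^+ 2 by rewrite ltr_wpDr// sqr_ge0.
have rho0 : 0 < rho by rewrite invr_gt0.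
pose q := Num.sqrt ((1 - rho) ^+ 2 + rho ^+ 2 * L ^+ 2).
have q2 : (1 - rho) ^+ 2 + rho ^+ 2 * L ^+ 2 = 1 - rho.
  by rewrite /rho; field; rewrite gt_eqF.
pose T x := x - rho *: (x + S x - g).
have VR x : V x -> V (x + S x - g).
  by move=> Vx; apply: VB => //; apply: VD => //; exact: VS.
have VT x : V x -> V (T x).
  by move=> Vx; apply: VB => //; apply: VZ; exact: VR.
have [||//|x y Vx Vy|w Vw Tw] := @contraction_fixpoint T q.
- exact: sqrtr_ge0.
- by rewrite /q q2 -[X in _ < X]sqrtr1 ltr_sqrt// ltrBlDr ltrDl.
- have VSS := VB (VS _ Vx) (VS _ Vy); have Vxy := VB Vx Vy.
  have -> : T x - T y = (1 - rho) *: (x - y) - rho *: (S x - S y).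
    have e : (x + S x - g) - (y + S y - g) = (x - y) + (S x - S y).
      by rewrite opprB addrA subrK opprD addrACA.
    rewrite scalerBl scale1r -[RHS]addrA -opprD -scalerDr -e scalerBr.
    by rewrite /T opprD opprK addrACA opprB [- _ + _]addrC.
  have V1 := @VZ (1 - rho) _ Vxy; have V2 := @VZ rho _ VSS.
  rewrite /N (semi_inner_sqrB V1 V2) (semi_innerZl _ Vxy V2) (semi_innerZr _ VSS Vxy).
  rewrite SB// !mulr0 subr0 (semi_inner_sqrZ _ Vxy) (semi_inner_sqrZ _ VSS).
  rewrite /q -sqrtrM; last first.
    by apply: addr_ge0; [exact: sqr_ge0|apply: mulr_ge0; exact: sqr_ge0].
  apply: ler_wsqrtr; rewrite [leRHS]mulrDl lerD2l -[leRHS]mulrA.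
  apply: ler_wpM2l; first exact: sqr_ge0.
  exact: NS.
exists w => // x Vx.
have : a (w + S w - g) x = 0.
  apply: semi_inner_null => //; first exact: VR.
  have : T w - w = (- rho) *: (w + S w - g) by rewrite /T addrC addKr scaleNr.
  move=> e; move: Tw; rewrite e semi_normZ; last exact: VR.
  by move=> /eqP; rewrite mulf_eq0 normr_eq0 oppr_eq0 gt_eqF//= => /eqP.
rewrite semi_innerBl//; last by apply: VD => //; exact: VS.
by rewrite semi_innerDl ?St ?gF//; [move/eqP; rewrite subr_eq0 => /eqP|exact: VS].
Qed.

Lemma picard_fixpoint (t : E -> E -> E -> R) (K C q : R) (F : E -> R) (P : set E) :
  (forall v w, V v -> V w -> linear_on V (fun u => t u v w)) ->
  (forall u w, V u -> V w -> linear_on V (fun v => t u v w)) ->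
  (forall u v, V u -> V v -> linear_on V (t u v)) ->
  (forall u v w, V u -> V v -> V w -> `|t u v w| <= K * N u * N v * N w) ->
  (forall u v, V u -> V v -> t u v v = 0) ->
  linear_on V F -> (forall x, V x -> `|F x| <= C * N x) ->
  0 <= q -> q < 1 ->
  (forall u v, V u -> V v -> (forall x, V x -> a v x + t u v x = F x) -> P v) ->
  (forall u v w, V u -> V v -> V w -> P v -> `|t u v w| <= q * N u * N w) ->
  exists2 v, V v & forall x, V x -> a v x + t v v x = F x.
Proof.
move=> t1 t2 t3 tK t0 Fl FC q0 q1 solP Pq.
have exT u : exists v, V u -> V v /\ forall x, V x -> a v x + t u v x = F x.
  have [Vu|nVu] := pselect (V u); last by exists 0.
  have [||||||v Vv Hv] := @lax_milgram_skew (t u) (K * N u) C F.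
  - by move=> z Vz; exact: t2.
  - by move=> z Vz; exact: t3.
  - by move=> x y Vx Vy; exact: tK.
  - by move=> x Vx; exact: t0.
  - exact: Fl.
  - exact: FC.
  - by exists v.
have [T HT] := choice exT.
have VT x : V x -> V (T x) by move=> /HT[].
have Teq x y : V x -> V y -> a (T x) y + t x (T x) y = F y.
  by move=> /HT[_]; apply.
have [//|//|//|x y Vx Vy|v Vv Tv] := @contraction_fixpoint T q.
  have VTx := VT _ Vx; have VTy := VT _ Vy.
  have VTT := VB VTx VTy; have Vxy := VB Vx Vy.
  have PTy : P (T y) by apply: (solP y) => // z Vz; exact: Teq.
  have := Pq _ _ _ Vxy VTy VTT PTy.
  (* Subtract the two linear problems and test with [T x - T y]. The difference of the [t] terms is
     [t x (T x - T y)] plus [t (x - y) (T y)], and the first of these vanishes by skewness. *)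
  have : N (T x - T y) ^+ 2 = - t (x - y) (T y) (T x - T y).
    rewrite sqr_semi_norm// semi_innerBl//.
    have := Teq x _ Vx VTT; have := Teq y _ Vy VTT.
    have := t0 x _ Vx VTT; rewrite (linear_onB hV (t2 _ _ Vx VTT))//.
    by rewrite (linear_onB hV (t1 _ _ VTy VTT))//; lra.
  set n1 := N (x - y); set n2 := N _ => e h.
  have n20 : 0 <= n2 by exact: semi_norm_ge0.
  have [->|n2n] := eqVneq n2 0; first by rewrite mulr_ge0 ?semi_norm_ge0.
  have h' : n2 * n2 <= q * n1 * n2.
    by apply: le_trans h; rewrite -expr2 e -normrN ler_norm.
  by move: h'; rewrite ler_pM2r// lt_neqAle eq_sym n2n.
(* [T v] and [v] differ by a null vector; [a] and the bounded form [t v] do not see it, so the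
   equation for [T v] holds for [v]. *)
exists v => // x Vx; have VTv := VT _ Vv; have VTB := VB VTv Vv.
have := Teq v x Vv Vx.
have : a (T v - v) x = 0 by exact: semi_inner_null.
rewrite semi_innerBl// => /eqP; rewrite subr_eq0 => /eqP ->.
have : t v (T v - v) x = 0.
  apply/eqP; rewrite -normr_le0; apply: le_trans (tK _ _ _ Vv VTB Vx) _.
  by rewrite Tv mulr0 mul0r.
rewrite (linear_onB hV (t2 _ _ Vv Vx))// => /eqP.
by rewrite subr_eq0 => /eqP ->.
Qed.

End semi_inner.

(** * Square integrable functions *)

Section square_integrable.
Context {d : measure_display} {T : measurableType d} {R : realType}.
Context (mu : {measure set T -> \bar R}) (D : set T) (mD : measurable D).

Definition rinteg (f : T -> R) := mu.-integrable D (EFin \o f).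

Lemma rinteg_measurable f : rinteg f -> measurable_fun D f.
Proof. by case/integrableP => /measurable_EFinP. Qed.

Lemma rinteg_ext f g : (forall x, D x -> f x = g x) -> rinteg f -> rinteg g.
Proof.
move=> fg; apply: eq_integrable => // x /set_mem Dx.
by rewrite /= fg.
Qed.

Lemma rintegD f g : rinteg f -> rinteg g -> rinteg (fun x => f x + g x).
Proof.
by move=> hf hg; exact: (integrableD mD hf hg).
Qed.

Lemma rintegZ k f : rinteg f -> rinteg (fun x => k * f x).
Proof.
by move=> hf; exact: (integrableZl mD k hf).
Qed.

Lemma rinteg0 : rinteg (fun=> 0).
Proof. exact: (integrable0 mu D). Qed.

Lemma rinteg_sum (J : Type) (s : seq J) (f : J -> T -> R) :
  (forall j, rinteg (f j)) -> rinteg (fun x => \sum_(j <- s) f j x).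
Proof.
move=> hf; elim: s => [|j s IH].
  by apply: rinteg_ext rinteg0 => x _; rewrite /= big_nil.
apply: rinteg_ext (rintegD (hf j) IH) => x _.
by rewrite big_cons.
Qed.

Lemma rinteg_le (f g : T -> R) : measurable_fun D f -> (forall x, D x -> `|f x| <= g x) ->
  rinteg g -> rinteg f.
Proof.
move=> mf fg hg; apply: (le_integrable mD _ _ hg).
  exact/measurable_EFinP.
move=> x Dx; rewrite /= lee_fin; apply: le_trans (fg _ Dx) _.
exact: ler_norm.
Qed.

Local Notation Int f := (\int[mu]_(x in D) f x).

Lemma Rintegral_ae (f g : T -> R) : measurable_fun D f -> measurable_fun D g ->
  ae_eq mu D f g -> Int f = Int g.
Proof.
move=> mf mg fg; rewrite /Rintegral; congr fine.
apply: ae_eq_integral => //; try exact/measurable_EFinP.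
by apply: filterS fg => x h /h /= ->.
Qed.

Lemma Rintegral_sum (J : Type) (s : seq J) (f : J -> T -> R) :
  (forall j, rinteg (f j)) ->
  \int[mu]_(x in D) (\sum_(j <- s) f j x) = \sum_(j <- s) Int (f j).
Proof.
move=> hf; elim: s => [|j s IH].
  rewrite big_nil (_ : (fun x => _) = cst 0); last by apply/funext => x; rewrite big_nil.
  by rewrite /Rintegral integral0.
rewrite big_cons -IH -(RintegralD mD (hf j) (rinteg_sum s hf)).
by apply: eq_Rintegral => x _; rewrite big_cons.
Qed.

Definition sq_integrable : set (T -> R) := fun p =>
  measurable_fun D p /\ rinteg (fun x => p x ^+ 2).

Lemma sq_integrableM p q : sq_integrable p -> sq_integrable q ->
  rinteg (fun x => p x * q x).
Proof.
move=> [mp ip] [mq iq]; apply: rinteg_le (rintegD ip iq).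
  exact: measurable_funM.
move=> x _; have := sqr_ge0 (p x - q x); have := sqr_ge0 (p x + q x).
by rewrite ler_norml !expr2 => h1 h2; apply/andP; split; nra.
Qed.

Lemma sq_integrable_linear : linear_set sq_integrable.
Proof.
split=> [|k x y hx hy].
  split; first exact: measurable_cst.
  by apply: rinteg_ext rinteg0 => x _; rewrite expr0n.
split.
  by apply: measurable_funD hy.1; apply: measurable_funM hx.1; exact: measurable_cst.
have h := rintegD (rintegZ (k ^+ 2) hx.2)
  (rintegD (rintegZ (2 * k) (sq_integrableM hx hy)) hy.2).
apply: rinteg_ext h => z _.
rewrite (_ : (k *: x + y) z = k * x z + y z)//; ring.
Qed.

Definition ipL2 (p q : T -> R) := \int[mu]_(x in D) (p x * q x).

Lemma ipL2_semi_inner : semi_inner sq_integrable ipL2.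
Proof.
split=> [z hz k x y hx hy|x y _ _|x _].
- rewrite /ipL2 -RintegralZl//; last exact: sq_integrableM.
  rewrite -RintegralD//; last 2 first.
  + by apply: rintegZ; exact: sq_integrableM.
  + exact: sq_integrableM.
  by apply: eq_Rintegral => t _; rewrite (_ : (k *: x + y) t = k * x t + y t)//; ring.
- by apply: eq_Rintegral => t _; rewrite mulrC.
- by apply: Rintegral_ge0 => t _; rewrite -expr2 sqr_ge0.
Qed.

Lemma rinteg_EFin f : rinteg f -> (Int f)%:E = (\int[mu]_(x in D) (f x)%:E)%E.
Proof. by move=> hf; rewrite /Rintegral fineK//; exact: integrable_fin_num. Qed.

Lemma Rintegral_eq0_ae f : rinteg f -> (forall x, D x -> 0 <= f x) -> Int f = 0 ->
  ae_eq mu D f (fun=> 0).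
Proof.
move=> hf f0 If; have mf := rinteg_measurable hf.
have /ae_eq_integral_abs : measurable_fun D (EFin \o f) by exact/measurable_EFinP.
move=> /(_ mu mD)[+ _]; set I := (X in X = _ -> _).
have -> : I = 0%E.
  rewrite -[RHS]/(0%:E) -If rinteg_EFin//.
  by apply: eq_integral => x /set_mem Dx /=; rewrite ger0_norm// f0.
by move=> /(_ erefl); apply: filterS => x h Dx; have [] := h Dx.
Qed.

Lemma ipL2_eq0_ae p : sq_integrable p -> ipL2 p p = 0 -> ae_eq mu D p (fun=> 0).
Proof.
move=> [mp ip] h; have := @Rintegral_eq0_ae (fun x => p x ^+ 2) ip.
rewrite (_ : Int (fun x => p x ^+ 2) = 0); last first.
  by rewrite -[RHS]h; apply: eq_Rintegral => x _; rewrite expr2.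
move=> /(_ (fun x _ => sqr_ge0 _) erefl); apply: filterS => x h' /h' /eqP.
by rewrite sqrf_eq0 => /eqP.
Qed.

End square_integrable.

(* The weight 2^k forces geometric decay of the increments, so square summability
   can be integrated termwise without Minkowski's inequality. *)
Lemma cvg_sum_sqr_increments (R : realType) (u : nat -> R) :
  (\sum_(0 <= k <oo) (2 ^+ k * (u k.+1 - u k) ^+ 2)%:E < +oo)%E -> cvgn u.
Proof.
set S := limn _ => Soo.
have t0 k : (0 <= (2 ^+ k * (u k.+1 - u k) ^+ 2)%:E)%E.
  by rewrite lee_fin mulr_ge0 ?sqr_ge0// exprn_ge0.
have S0 : (0 <= S)%E by apply: nneseries_ge0 => k _ _; exact: t0.
pose G := fine S.
have SG : S = G%:E by rewrite /G fineK// ge0_fin_numE.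
have G0 : 0 <= G by rewrite -lee_fin -SG.
have term k : 2 ^+ k * (u k.+1 - u k) ^+ 2 <= G.
  rewrite -lee_fin -SG; apply: le_trans; last first.
    by apply: (nneseries_lim_ge k.+1) => n _ _; exact: t0.
  rewrite big_nat_recr//= leeDr// sume_ge0// => n _; exact: t0.
(* [term] bounds the squared increment by [G] times the [k]-th power of 1/2, so the increments decay
   like powers of [r]. *)
pose r : R := Num.sqrt 2^-1.
have r0 : 0 <= r by exact: sqrtr_ge0.
have r1 : r < 1 by rewrite -[X in _ < X]sqrtr1 ltr_sqrt// invf_lt1// ltr1n.
have hk k : `|u k.+1 - u k| <= Num.sqrt G * r ^+ k.
  rewrite -(@ler_pXn2r _ 2) ?nnegrE ?mulr_ge0 ?exprn_ge0 ?sqrtr_ge0//.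
  rewrite exprMn sqr_sqrtr// real_normK ?num_real// -exprM mulnC exprM.
  rewrite sqr_sqrtr ?invr_ge0// exprVn ler_pdivlMr ?exprn_gt0//.
  by rewrite mulrC.
suff : cvgn (series (telescope u)).
  rewrite telescopeK => cs.
  have -> : u = (fun n => (u n - u 0) + u 0) by apply/funext => n; rewrite subrK.
  by apply: is_cvgD => //; exact: is_cvg_cst.
apply: normed_cvg; apply: series_le_cvg (@is_cvg_geometric_series R (Num.sqrt G) r _).
- by move=> n /=.
- by move=> n; rewrite /= mulr_ge0 ?exprn_ge0 ?sqrtr_ge0.
- by move=> n; exact: hk.
- by rewrite ger0_norm.
Qed.

Lemma sum_geometric_quarter_lty (R : realType) :
  (\sum_(0 <= k <oo) ((4^-1 : R) ^+ k)%:E < +oo)%E.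
Proof.
have q0 k : (0 <= ((4^-1 : R) ^+ k)%:E)%E by rewrite lee_fin exprn_ge0// invr_ge0.
apply: le_lt_trans (ltry (2 : R)); apply: lime_le.
  by apply: is_cvg_nneseries => n _ _; exact: q0.
apply: nearW => n; rewrite sumEFin lee_fin.
suff : \sum_(0 <= i < n) (4^-1 : R) ^+ i <= 2 * (1 - 4^-1 ^+ n).
  by move=> /le_trans; apply; rewrite ler_piMr// gerBl exprn_ge0// invr_ge0.
elim: n => [|n IH]; first by rewrite big_geq// expr0 subrr mulr0.
rewrite big_nat_recr//= exprS.
have : 0 <= (4^-1 : R) ^+ n by rewrite exprn_ge0// invr_ge0.
by move: IH; lra.
Qed.

(** * Completeness of L^2 (Riesz-Fischer) *)

Section complete.
Context {d : measure_display} {T : measurableType d} {R : realType}.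
Context (mu : {measure set T -> \bar R}) (D : set T) (mD : measurable D).
Local Notation L2 := (sq_integrable mu D).
Local Notation a := (ipL2 mu D).

Lemma ipL2_EFin p q : L2 p -> L2 q ->
  (a p q)%:E = (\int[mu]_(x in D) (p x * q x)%:E)%E.
Proof. by move=> hp hq; rewrite rinteg_EFin//; exact: sq_integrableM. Qed.

(** The rate [8^-1 ^+ k] absorbs the weight [2 ^+ k]: the weighted squared increments have integrals
    at most [4^-1 ^+ k]. Their sum is then integrable, hence finite almost everywhere. *)
Lemma rapid_cauchy_cvg_ae (s : nat -> T -> R) : (forall n, L2 (s n)) ->
  (forall k, a (s k.+1 - s k) (s k.+1 - s k) < 8^-1 ^+ k) ->
  {ae mu, forall x, D x -> cvgn (fun k => s k x)}.
Proof.
move=> Ls s8; have hV := sq_integrable_linear mu mD.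
have Lh k : L2 (s k.+1 - s k) by exact: (linear_setB hV).
pose f k x : \bar R := (2 ^+ k * (s k.+1 x - s k x) ^+ 2)%:E.
have f0 k x : D x -> (0 <= f k x)%E.
  by rewrite lee_fin mulr_ge0 ?sqr_ge0// exprn_ge0.
have rf k : rinteg mu D (fun x => 2 ^+ k * (s k.+1 x - s k x) ^+ 2).
  apply: rintegZ => //; apply: rinteg_ext (sq_integrableM mD (Lh k) (Lh k)) => // x _.
have mf k : measurable_fun D (f k).
  by apply/measurable_EFinP; exact: rinteg_measurable (rf k).
pose g x := (\sum_(0 <= k <oo) f k x)%E.
have ig : mu.-integrable D g.
  apply/integrableP; split; first by apply: ge0_emeasurable_sum => // k x Dx _; exact: f0.
  rewrite (_ : integral _ _ _ = \int[mu]_(x in D) g x)%E; last first.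
    by apply: eq_integral => x /set_mem Dx; rewrite gee0_abs// nneseries_ge0// => k _ _;
       exact: f0.
  rewrite integral_nneseries//.
  apply: le_lt_trans (sum_geometric_quarter_lty R); apply: lee_nneseries => k _.
    by move=> _; apply: integral_ge0; exact: f0.
  rewrite -rinteg_EFin// lee_fin RintegralZl//; last first.
    apply: (rinteg_ext mD) (sq_integrableM mD (Lh k) (Lh k)) => // x _.
  have -> : (4^-1 : R) ^+ k = 2 ^+ k * 8^-1 ^+ k by rewrite -exprMn; congr (_ ^+ _); field.
  rewrite ler_wpM2l ?exprn_ge0//; apply: le_trans (ltW (s8 k)).
  rewrite le_eqVlt; apply/orP; left; apply/eqP; apply: eq_Rintegral => x _.
  by rewrite expr2.
apply: filterS (integrable_ae mD ig) => x h Dx.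
apply: cvg_sum_sqr_increments; have := h Dx.
by rewrite ge0_fin_numE// nneseries_ge0// => k _ _; exact: f0.
Qed.

(** A rapidly Cauchy subsequence has a pointwise limit [p] almost everywhere; Fatou's lemma, applied
    to the squared distance from [s m] to the subsequence, bounds the distance from [s m] to [p]. *)
Lemma sq_integrable_complete : complete_for L2 a.
Proof.
move=> s Ls sC; have hV := sq_integrable_linear mu mD.
have [N HN] := choice (fun k => sC (8^-1 ^+ k) ltac:(by rewrite exprn_gt0)).
(* Summing all thresholds up to [k] and adding [k] gives an index that exceeds [N k], is monotone
   and tends to infinity. *)
pose n k := (\sum_(i < k.+1) N i + k)%N.
have nN k : (N k <= n k)%N by rewrite /n big_ord_recr -addnA addnC -addnA leq_addr.
have nS k : (n k <= n k.+1)%N.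
  by rewrite /n [leqRHS]addnS leqW// [in leqRHS]big_ord_recr leq_add2r leq_addr.
have nk k : (k <= n k)%N by rewrite /n leq_addl.
have aes : {ae mu, forall x, D x -> cvgn (fun k => s (n k) x)}.
  apply: rapid_cauchy_cvg_ae => // k.
  by apply: HN; [exact: leq_trans (nN k) (nS k)|exact: nN].
(* The upper limit is measurable whether or not the sequence converges; where it is infinite, [fine]
   returns 0. *)
pose p x := fine (limn_esup (fun k => (s (n k) x)%:E)).
have mp : measurable_fun D p.
  apply: measurableT_comp; first exact: fine_measurable.
  by apply: measurable_fun_limn_esup => k; apply/measurable_EFinP; exact: (Ls _).1.
have sp : {ae mu, forall x, D x -> (fun k => s (n k) x) @ \oo --> p x}.
  apply: filterS aes => x h Dx; have cs := h Dx.
  rewrite /p is_cvg_limn_esupE; last by apply/cvg_ex; exists (limn (fun k => s (n k) x))%:E;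
    apply/fine_cvgP; split; [exact: nearW|].
  by rewrite EFin_lim.
have key e : 0 < e -> exists M, forall m, (M <= m)%N -> L2 (s m - p) /\
    a (s m - p) (s m - p) <= e.
  move=> e0; have [M HM] := sC _ e0; exists M => m Mm.
  (* The shift by [M] puts every index [n (k + M)] beyond [M], so the Cauchy bound holds for all
     [k]. *)
  pose q k x := s m x - s (n (k + M)%N) x.
  have Lq k : L2 (q k) by exact: (linear_setB hV (Ls m) (Ls (n (k + M)%N))).
  pose F k x := ((q k x) ^+ 2)%:E.
  have mF k : measurable_fun D (F k).
    by apply/measurable_EFinP; exact: rinteg_measurable (Lq k).2.
  have mr : measurable_fun D (fun x => (((s m - p) x) ^+ 2)%:E).
    apply/measurable_EFinP; apply: measurable_funX; apply: measurable_funB => //.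
    exact: (Ls m).1.
  have mlF : measurable_fun D (fun x => limn_einf (F^~ x)).
    under eq_fun do rewrite -[limn_einf _]oppeK -limn_esupN.
    apply: measurableT_comp => //; apply: measurable_fun_limn_esup => k.
    exact: measurableT_comp.
  have Ile : (\int[mu]_(x in D) (((s m - p) x) ^+ 2)%:E <= e%:E)%E.
    rewrite (_ : integral _ _ _ = \int[mu]_(x in D) limn_einf (F^~ x))%E; last first.
      apply: ae_eq_integral => //; apply: filterS sp => x h Dx.
      have : F^~ x @ \oo --> (((s m - p) x) ^+ 2)%:E.
        apply/fine_cvgP; split; first exact: nearW.
        rewrite /comp /=; have c : (fun k => q k x) @ \oo --> (s m - p) x.
          apply: cvgB; first exact: cvg_cst.
          by have := h Dx; rewrite -(cvg_shiftn M).
        by rewrite expr2; under eq_fun do rewrite expr2; exact: cvgM.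
      move=> c; rewrite is_cvg_limn_einfE; first by rewrite (cvg_lim _ c).
      by apply/cvg_ex; eexists; exact: c.
    apply: le_trans (fatou mu mD mF _) _.
      by move=> k x _; rewrite lee_fin sqr_ge0.
    rewrite limn_einf_lim; apply: lime_le; first exact: is_cvg_einfs.
    apply: nearW => k; apply: (@le_trans _ _ (\int[mu]_(x in D) F k x)%E).
      by apply: ereal_inf_lbound; exists k => /=.
    rewrite -rinteg_EFin//; last exact: (Lq k).2.
    rewrite lee_fin; have := HM m (n (k + M)%N) Mm (leq_trans (leq_addl _ _) (nk _)).
    move=> /ltW; apply: le_trans; rewrite le_eqVlt; apply/orP; left; apply/eqP.
    by apply: eq_Rintegral => x _; rewrite expr2.
  have Lsp : L2 (s m - p).
    split; first by apply: measurable_funB => //; exact: (Ls m).1.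
    apply/integrableP; split=> //.
    apply: le_lt_trans (ltry e); apply: le_trans Ile.
    rewrite le_eqVlt; apply/orP; left; apply/eqP; apply: eq_integral => x _ /=.
    by rewrite ger0_norm// sqr_ge0.
  by split=> //; rewrite -lee_fin ipL2_EFin.
have [|M1 /(_ M1 (leqnn _))[LM _]] := key 1; first by [].
exists p.
  have -> : p = s M1 - (s M1 - p) by rewrite opprB addrC subrK.
  exact: (linear_setB hV).
move=> e e0; have [|M HM] := key (e / 2); first by rewrite divr_gt0.
by exists M => m /HM[_] /le_lt_trans; apply; rewrite ltr_pdivrMr// ltr_pMr// ltr1n.
Qed.

End complete.

(** * Lebesgue measure and test functions on row vectors *)

Section row_topology.
Context {R : realType}.

Lemma row_ballE n (x y : 'rV[R]_n) (e : R) :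
  0 < e -> (forall i, `|x ord0 i - y ord0 i| < e) -> ball x e y.
Proof. by move=> e0 h; split=> // i j; rewrite ord1; exact: h. Qed.

Lemma measurable_row_ball n (x : 'rV[R]_n) (e : R) : measurable (ball x e).
Proof.
have [e0|e0] := ltP 0 e; last first.
  rewrite (_ : ball x e = set0)//; apply/seteqP; split => // y [].
  by rewrite ltNge e0.
rewrite (_ : ball x e = \bigcap_(i in [set: 'I_n])
    (@row_coord R n i @^-1` ball (x ord0 i) e)); last first.
  apply/seteqP; split => [y [_ h] i _|y h]; first exact: h.
  by apply: row_ballE => // i; exact: h.
apply: fin_bigcap_measurable => // i _.
rewrite -[X in measurable X]setTI; apply: measurable_row_coord => //.
exact: measurable_ball.
Qed.

Lemma row_rat_approx n (x : 'rV[R]_n) (e : R) : 0 < e ->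
  exists q : 'rV[rat]_n, ball (map_mx (@ratr R) q) e x.
Proof.
move=> e0; have h i : exists q : rat, `|ratr q - x ord0 i| < e.
  have [|q] := @rat_in_itvoo R (x ord0 i - e) (x ord0 i + e).
    by rewrite ltrBlDr -addrA ltrDl addr_gt0.
  rewrite in_itv /= => /andP[h1 h2]; exists q.
  by rewrite ltr_distl h1 h2.
have [q Hq] := choice h.
by exists (\row_i q i); apply: row_ballE => // i; rewrite !mxE.
Qed.

(** The sigma-algebra is generated by the coordinates, so an open set is written as a countable
    union of balls with rational centre and radius [k.+1%:R^-1]. [F] replaces by [set0] the balls
    that are not inside [A]. *)
Lemma open_row_measurable n (A : set 'rV[R]_n) : open A -> measurable A.
Proof.
move=> oA; pose F (p : 'rV[rat]_n * nat) : set 'rV[R]_n :=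
  if `[< ball (map_mx (@ratr R) p.1) p.2.+1%:R^-1 `<=` A >]
  then ball (map_mx (@ratr R) p.1) p.2.+1%:R^-1 else set0.
rewrite (_ : A = \bigcup_p F p).
  apply: countable_bigcupT_measurable; first exact: countableP.
  by move=> p; rewrite /F; case: ifP => // _; exact: measurable_row_ball.
apply/seteqP; split => [x Ax|x [p _]]; last first.
  by rewrite /F; case: asboolP => // + xp; apply.
have /nbhs_ballP[e /= e0 eA] := open_nbhs_nbhs (conj oA Ax).
have [k _ Hk] : \forall k \near \oo, k.+1%:R^-1 < e / 2.
  have := @cvg_harmonic R; have e20 : 0 < e / 2 by rewrite divr_gt0.
  move=> /cvgrPdist_lt /(_ _ e20); apply: filterS => k.
  by rewrite sub0r normrN; apply: le_lt_trans; exact: ler_norm.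
have k0 : 0 < k.+1%:R^-1 :> R by rewrite invr_gt0.
have [q xq] := row_rat_approx x k0.
exists (q, k) => //; rewrite /F; case: asboolP => //= -[] y yq; apply: eA.
have := Hk k (leqnn _) => ke.
apply: (@le_ball _ _ _ (k.+1%:R^-1 + k.+1%:R^-1)).
  by move: ke; move: (k.+1%:R^-1) => p; lra.
by apply: ball_triangle yq; exact: ball_sym.
Qed.

Lemma continuous_row_measurable n (f : 'rV[R]_n -> R) :
  continuous f -> measurable_fun setT f.
Proof.
move=> /continuousP cf; apply: (measurability _ (RGenOpens.measurableE R)).
move=> _ [_ [a [b ->]] <-]; rewrite setTI; apply: open_row_measurable.
exact/cf/interval_open.
Qed.

End row_topology.

Lemma bounded_support_integrable d (T : measurableType d) (R : realType)
    (mu : {measure set T -> \bar R}) (S : set T) (B : R) (f : T -> R) :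
  measurable S -> (mu S < +oo)%E -> measurable_fun setT f ->
  (forall x, `|f x| <= B) -> (forall x, ~ S x -> f x = 0) -> rinteg mu setT f.
Proof.
move=> mS Sfin mf fB f0.
apply: (@rinteg_le _ _ _ mu _ measurableT _ (fun x => B * \1_S x)) => //.
  move=> x _; rewrite indicE; case: (pselect (S x)) => Sx.
    by rewrite mem_set// mulr1.
  by rewrite f0// normr0 memNset// mulr0.
apply: rintegZ => //; apply/integrableP; split.
  by apply/measurable_EFinP; exact: measurable_indic.
rewrite (_ : integral _ _ _ = mu S)//.
under eq_integral do rewrite /= ger0_norm//.
by rewrite integral_indic// setIT.
Qed.

Section row_integral.
Context {R : realType}.

(** Cubes are convenient supports: [row_cons] pulls a cube back to a product of an interval and a
    smaller cube, matching the recursive construction of [lebesgue_row]. *)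
Definition row_box n (r : R) : set 'rV[R]_n := [set x | forall i, `|x ord0 i| <= r].
Arguments row_box n r : clear implicits.

Lemma row_boxE n r : row_box n r = [set x | forall i, `[(- r), r]%classic (x ord0 i)].
Proof.
apply/seteqP; split => x h i; have := h i; rewrite /= ?in_itv /= -ler_norml//.
Qed.

Lemma row_box_compact n r : compact (row_box n r).
Proof.
rewrite row_boxE; apply: (@rV_compact R n (fun=> `[(- r), r]%classic)) => i.
exact: segment_compact.
Qed.

Lemma row_box_measurable n r : measurable (row_box n r).
Proof.
have -> : row_box n r = \bigcap_(i in [set: 'I_n])
    (@row_coord R n i @^-1` `[(- r), r]%classic).
  by rewrite row_boxE; apply/seteqP; split => [y h i _|y h i]; exact: h.
apply: fin_bigcap_measurable => // i _.
rewrite -[X in measurable X]setTI; exact: measurable_row_coord.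
Qed.

Lemma row_cons_box n r : @row_cons R n @^-1` row_box n.+1 r =
  `[(- r), r]%classic `*` row_box n r.
Proof.
apply/seteqP; split => -[t y] /=.
  move=> h; split; last by move=> i; have := h (lift ord0 i); rewrite mxE liftK.
  by have := h ord0; rewrite mxE unlift_none /= in_itv /= -ler_norml.
rewrite in_itv /= -ler_norml => -[ht hy] i; rewrite mxE.
by case: unliftP => [j|] _ /=; [exact: hy|exact: ht].
Qed.

Lemma row_box_finite n r : (lebesgue_row R n (row_box n r) < +oo)%E.
Proof.
elim: n => [|n IH]; first by rewrite /= diracE ltry.
rewrite /= /row_measure /pushforward row_cons_box product_measure1E//; last first.
  exact: row_box_measurable.
apply: lte_mul_pinfty => //.
rewrite ge0_fin_numE//.
suff : (lebesgue_measure (`[(- r)%R, r]%classic : set R) < +oo)%E by [].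
rewrite lebesgue_measure_itv/= lte_fin; case: ifP => // _.
by rewrite -EFinD ltry.
Qed.

Lemma row_cons_box_finite n r :
  ((@lebesgue_measure R \x lebesgue_row R n)%E (@row_cons R n @^-1` row_box n.+1 r) < +oo)%E.
Proof. exact: (row_box_finite n.+1 r). Qed.

Lemma continuous_support_bounded n (f : 'rV[R]_n -> R) r : continuous f ->
  (forall x, ~ row_box n r x -> f x = 0) -> exists B, forall x, `|f x| <= B.
Proof.
move=> cf f0.
have : compact (f @` row_box n r).
  apply: continuous_compact; first exact: continuous_subspaceT.
  exact: row_box_compact.
move=> /compact_bounded[M [_ HM]].
exists (`|M| + 1) => x; have [bx|bx] := pselect (row_box n r x); last first.
  by rewrite f0// normr0 addr_ge0.
apply: (HM (`|M| + 1)); last by exists x.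
by rewrite ltr_pwDr// ler_norm.
Qed.

Lemma continuous_support_integrable n (f : 'rV[R]_n -> R) r : continuous f ->
  (forall x, ~ row_box n r x -> f x = 0) -> rinteg (lebesgue_row R n) setT f.
Proof.
move=> cf f0; have [B fB] := continuous_support_bounded cf f0.
apply: (bounded_support_integrable _ _ _ fB f0); [|exact: row_box_finite|].
  exact: row_box_measurable.
exact: continuous_row_measurable.
Qed.

Lemma integral_lebesgue_rowS n (f : 'rV[R]_n.+1 -> R) r : continuous f ->
  (forall x, ~ row_box n.+1 r x -> f x = 0) ->
  (@lebesgue_measure R \x lebesgue_row R n)%E.-integrable setT
    (fun p => (f (row_cons p))%:E) /\
  (\int[lebesgue_row R n.+1]_x (f x)%:E =
   \int[@lebesgue_measure R \x lebesgue_row R n]_p (f (row_cons p))%:E)%E.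
Proof.
move=> cf f0; have [B fB] := continuous_support_bounded cf f0.
have mf := continuous_row_measurable cf.
have h : rinteg (@lebesgue_measure R \x lebesgue_row R n)%E setT (f \o @row_cons R n).
  apply: (@bounded_support_integrable _ _ _ _ (@row_cons R n @^-1` row_box n.+1 r) B).
  - rewrite row_cons_box; apply: measurableX => //; exact: row_box_measurable.
  - exact: row_cons_box_finite.
  - by apply: measurableT_comp => //; exact: measurable_row_cons.
  - by move=> p; exact: fB.
  - by move=> p; exact: f0.
split; first exact: h.
rewrite [LHS]integral_pushforward//.
- exact: measurable_row_cons.
- exact/measurable_EFinP.
Qed.

End row_integral.
Arguments row_box {R} n r.

(** * Integrals of partial derivatives *)

Section partial.
Context {R : realType}.

Lemma row_cons_shift0 n (t h : R) (y : 'rV[R]_n) :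
  row_cons (h + t, y) = h *: 'e_ord0 + row_cons (t, y).
Proof.
apply/rowP => j; rewrite !mxE eqxx /=; case: unliftP => [k ->|->] /=.
  by rewrite mulr0 add0r.
by rewrite mulr1.
Qed.

Lemma row_cons_shift_lift n (t h : R) (y : 'rV[R]_n) (k : 'I_n) :
  row_cons (t, h *: 'e_k + y) = h *: 'e_(lift ord0 k) + row_cons (t, y).
Proof.
apply/rowP => j; rewrite !mxE eqxx /=; case: unliftP => [l ->|->] /=.
  by rewrite !mxE eqxx /= (inj_eq lift_inj).
by rewrite mulr0 add0r.
Qed.

Lemma row_cons_continuous1 n (y : 'rV[R]_n) :
  continuous (fun t : R => row_cons (t, y) : 'rV[R]_n.+1).
Proof.
move=> t; apply/cvg_ballP => e e0; near=> s; apply: row_ballE => // i.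
rewrite !mxE; case: unliftP => [k|] _ /=; first by rewrite subrr normr0.
by near: s; exact: (@cvgr_dist_lt _ _ _ _ _ id t).
Unshelve. all: by end_near. Qed.

Lemma row_cons_continuous2 n (t : R) :
  continuous (fun y : 'rV[R]_n => row_cons (t, y) : 'rV[R]_n.+1).
Proof.
move=> y; apply/(@cvg_ballP _ _ _ _ (fmap_filter _ (nbhs_filter y))) => e e0.
have : nbhs y (ball y e) by exact: nbhsx_ballx.
apply: filterS => z [_ yz]; apply: row_ballE => // i; rewrite !mxE.
by case: unliftP => [k|] _ /=; [exact: yz|rewrite subrr normr0].
Qed.

Lemma derive_row_cons1 n (f : 'rV[R]_n.+1 -> R) (t : R) (y : 'rV[R]_n) :
  'D_1 (fun s => f (row_cons (s, y))) t = 'D_'e_ord0 f (row_cons (t, y)) /\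
  (derivable f (row_cons (t, y)) 'e_ord0 ->
   derivable (fun s => f (row_cons (s, y))) t 1).
Proof.
rewrite /derive /derivable.
have -> : (fun h : R => h^-1 *: (((fun s => f (row_cons (s, y))) \o shift t) (h *: (1 : R)) -
    f (row_cons (t, y)))) =
  (fun h => h^-1 *: ((f \o shift (row_cons (t, y))) (h *: 'e_ord0) - f (row_cons (t, y)))).
  by apply/funext => h; rewrite /= -row_cons_shift0 [h *: 1]mulr1.
by [].
Qed.

Lemma derive_row_cons2 n (f : 'rV[R]_n.+1 -> R) (t : R) (y : 'rV[R]_n) (k : 'I_n) :
  'D_'e_k (fun z => f (row_cons (t, z))) y = 'D_'e_(lift ord0 k) f (row_cons (t, y)) /\
  (derivable f (row_cons (t, y)) 'e_(lift ord0 k) ->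
   derivable (fun z => f (row_cons (t, z))) y 'e_k).
Proof.
rewrite /derive /derivable.
have -> : (fun h : R => h^-1 *: (((fun z => f (row_cons (t, z))) \o shift y) (h *: 'e_k) -
    f (row_cons (t, y)))) =
  (fun h => h^-1 *: ((f \o shift (row_cons (t, y))) (h *: 'e_(lift ord0 k)) -
    f (row_cons (t, y)))).
  by apply/funext => h; rewrite /= -row_cons_shift_lift.
by [].
Qed.

Lemma derive_support n (f : 'rV[R]_n -> R) (K : set 'rV[R]_n) v : closed K ->
  (forall x, ~ K x -> f x = 0) -> forall x, ~ K x -> 'D_v f x = 0.
Proof.
move=> cK f0 x Kx.
have Kx' : nbhs x (~` K) by apply: open_nbhs_nbhs; split => //; exact: closed_openC.
rewrite (@near_eq_derive _ _ _ _ (cst 0)) ?derive_cst//.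
by apply: filterS Kx' => y; exact: f0.
Qed.

Lemma row_box_closed n (r : R) : closed (row_box n r).
Proof. apply: compact_closed; [exact: norm_hausdorff|exact: row_box_compact]. Qed.

(** Fubini splits off the first coordinate. If [i] is a later coordinate, the inner integral
    vanishes by induction on each slice; if [i] is the first one, it is integrated first, by the
    fundamental theorem of calculus on an interval whose endpoints are outside the support. *)
Lemma integral_partial_eq0 n (i : 'I_n) (f : 'rV[R]_n -> R) (r : R) :
  continuous f -> (forall x, derivable f x 'e_i) ->
  continuous (fun x => 'D_'e_i f x) -> (forall x, ~ row_box n r x -> f x = 0) ->
  (\int[lebesgue_row R n]_x ('D_'e_i f x)%:E = 0)%E.
Proof.
elim: n i f => [[]//|n IH] i f cf df cdf f0.
have [iD ->] := integral_lebesgue_rowS cdf (derive_support _ (@row_box_closed _ r) f0).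
case: (unliftP ord0 i) df cdf iD => [k ->|->] df cdf iD.
  rewrite -integral12_prod_meas1//; apply: integral0_eq => t _.
  rewrite /fubini_F; under eq_integral do rewrite -(derive_row_cons2 f t _ k).1.
  apply: IH.
  - move=> y; apply: (@continuous_comp _ _ _ (fun z => row_cons (t, z)) f); last exact: cf.
    exact: row_cons_continuous2.
  - by move=> y; apply: (derive_row_cons2 f t y k).2.
  - rewrite (_ : (fun _ => _) = (fun y => 'D_'e_(lift ord0 k) f (row_cons (t, y)))).
      move=> y; apply: (@continuous_comp _ _ _ (fun z => row_cons (t, z)) ('D_'e_(lift ord0 k) f)).
        exact: row_cons_continuous2.
      exact: cdf.
    by apply/funext => y; rewrite (derive_row_cons2 f t y k).1.
  - move=> y yr; apply: f0; apply: contra_not yr => h j.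
    by have := h (lift ord0 j); rewrite mxE liftK.
rewrite -integral21_prod_meas1//; apply: integral0_eq => y _.
(* [b] exceeds [r] and is positive whatever the sign of [r], so [F] vanishes at [b] and at [- b]. *)
rewrite /fubini_G; pose b := `|r| + 1; pose F t := f (row_cons (t, y)).
have rb : r < b by rewrite ltr_pwDr// ler_norm.
have b0 : 0 < b by rewrite ltr_wpDl.
have out t : r < `|t| -> ~ row_box n.+1 r (row_cons (t, y)).
  move=> rt /(_ ord0); rewrite mxE unlift_none /= => h.
  by move: rt; rewrite ltNge h.
have cF : continuous F.
  move=> t; apply: (@continuous_comp _ _ _ (fun s => row_cons (s, y)) f); last exact: cf.
  exact: row_cons_continuous1.
have FE : continuous (fun t => 'D_'e_ord0 f (row_cons (t, y))).
  move=> t; apply: (@continuous_comp _ _ _ (fun s => row_cons (s, y)) ('D_'e_ord0 f)).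
    exact: row_cons_continuous1.
  exact: cdf.
transitivity (\int[lebesgue_measure]_(t in `[(- b)%R, b]) ('D_'e_ord0 f (row_cons (t, y)))%:E)%E.
  rewrite [RHS]integral_mkcond; apply: eq_integral => t _; rewrite patchE.
  case: ifPn => //; rewrite notin_setE /= in_itv /= -ler_norml => /negP.
  rewrite -ltNge => bt; rewrite (derive_support _ (@row_box_closed _ r) f0)//.
  by apply: out; exact: lt_trans bt.
rewrite (@continuous_FTC2 _ _ F).
- by rewrite /F !f0 ?subee//; apply: out; rewrite ?normrN gtr0_norm.
- by rewrite gtrN.
- exact: continuous_subspaceT.
- split; first by move=> t _; exact: (derive_row_cons1 f t y).2.
  + exact/cvg_at_right_filter/cF.
  + exact/cvg_at_left_filter/cF.
- by move=> t _; rewrite derive1E (derive_row_cons1 f t y).1.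
Qed.

End partial.

(** * Smooth functions and Leibniz's rule *)

Section smooth.
Context {R : realType} {n : nat}.
Implicit Types f g : 'rV[R]_n -> R.

Definition smooth f : Prop :=
  (forall s, continuous (iter_partial f s)) /\
  (forall s i x, derivable (iter_partial f s) x 'e_i).

Lemma smoothP f : (forall k, Ck_fun k f) <-> smooth f.
Proof.
split=> [h|[h1 h2] k]; last by split=> *; [exact: h1|exact: h2].
by split=> s *; [exact: (h (size s)).1|exact: (h (size s).+1).2].
Qed.

Lemma smooth_partial f i : smooth f -> smooth (fun x => 'D_'e_i f x).
Proof.
move=> [h1 h2]; have e s : iter_partial (fun x => 'D_'e_i f x) s = iter_partial f (rcons s i).
  by rewrite /iter_partial -cats1 foldr_cat.
by split=> s *; rewrite e; [exact: h1|exact: h2].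
Qed.

Lemma iter_partial_lin (k : R) f g s : smooth f -> smooth g ->
  iter_partial (k *: f + g) s = k *: iter_partial f s + iter_partial g s.
Proof.
move=> [_ df] [_ dg]; elim: s => [//|i s IH] /=; apply/funext => x.
rewrite IH deriveD//; last exact: derivableZ.
by rewrite deriveZ.
Qed.

Lemma smooth_lin (k : R) f g : smooth f -> smooth g -> smooth (k *: f + g).
Proof.
move=> sf sg; split=> [s x|s i x]; rewrite iter_partial_lin//.
  exact: (cvgD (cvgM (cvg_cst k) (sf.1 s x)) (sg.1 s x)).
by apply: derivableD; [apply: derivableZ; exact: sf.2|exact: sg.2].
Qed.

(** The shape of an iterated partial derivative of [f * g]. Each entry of [l] says which derivatives
    fall on [f] and which on [g]; repeated entries play the part of the binomial coefficients. *)
Definition sum_partialM f g (l : seq (seq 'I_n * seq 'I_n)) : 'rV[R]_n -> R :=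
  \sum_(p <- l) (iter_partial f p.1 * iter_partial g p.2).

Lemma sum_partialM_derivable f g l i x : smooth f -> smooth g ->
  derivable (sum_partialM f g l) x 'e_i.
Proof.
move=> sf sg; rewrite /sum_partialM; elim: l => [|p l IH].
  by rewrite big_nil; exact: derivable_cst.
rewrite big_cons; apply: derivableD => //.
by apply: derivableM; [exact: sf.2|exact: sg.2].
Qed.

Lemma sum_partialM_derive f g l i : smooth f -> smooth g ->
  exists l', (fun x => 'D_'e_i (sum_partialM f g l) x) = sum_partialM f g l'.
Proof.
move=> sf sg; elim: l => [|p l [l' IH]].
  exists [::]; rewrite /sum_partialM big_nil; apply/funext => x.
  exact: derive_cst.
exists [:: (p.1, i :: p.2), (i :: p.1, p.2) & l'].
apply/funext => x; have := congr1 (fun h => h x) IH => /= e.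
rewrite /sum_partialM !big_cons /= deriveD; last 2 first.
- by apply: derivableM; [exact: sf.2|exact: sg.2].
- exact: sum_partialM_derivable.
rewrite e deriveM; [|exact: sf.2|exact: sg.2].
rewrite /sum_partialM addrA.
by congr (_ + _ + _); rewrite mulrC.
Qed.

Lemma iter_partialM f g s : smooth f -> smooth g ->
  exists l, iter_partial (f * g) s = sum_partialM f g l.
Proof.
move=> sf sg; elim: s => [|i s [l IH]] /=.
  by exists [:: ([::], [::])]; rewrite /sum_partialM big_seq1.
by rewrite IH; exact: sum_partialM_derive.
Qed.

Lemma smoothM f g : smooth f -> smooth g -> smooth (f * g).
Proof.
move=> sf sg; split=> s.
  have [l ->] := iter_partialM s sf sg; rewrite /sum_partialM.
  elim: l => [|p l IH]; first by rewrite big_nil; exact: cst_continuous.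
  move=> x; rewrite big_cons.
  exact: (cvgD (cvgM (sf.1 p.1 x) (sg.1 p.2 x)) (IH x)).
move=> i x; have [l ->] := iter_partialM s sf sg.
exact: sum_partialM_derivable.
Qed.

End smooth.

(** * Test functions and integration by parts *)

Section test_functions.
Context {R : realType} {d : nat} (Om : set 'rV[R]_d).
Hypothesis oOm : open Om.
Local Notation mu := (lebesgue_row R d).
Local Notation test := (test_fun Om).
Local Notation L2 := (sq_integrable mu Om).

Let mOm : measurable Om. Proof. exact: open_row_measurable. Qed.

Lemma test_fun_smooth f : test f -> smooth f.
Proof. by case=> /smoothP. Qed.

Lemma test_fun_linear : linear_set test.
Proof.
split=> [|k f g [/smoothP sf [K [cK KO f0]]] [/smoothP sg [L [cL LO g0]]]].
  split; last by exists set0; split => //; exact: compact0.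
  apply/smoothP; have e s : iter_partial (0 : 'rV[R]_d -> R) s = cst 0.
    elim: s => [//|i s /= ->]; apply/funext => x; exact: derive_cst.
  by split=> s *; rewrite e; [exact: cst_continuous|exact: derivable_cst].
split; first by apply/smoothP; exact: smooth_lin.
exists (K `|` L); split; first exact: compactU.
  by rewrite subUset.
move=> x /not_orP[Kx Lx]; rewrite (_ : (k *: f + g) x = k * f x + g x)//.
by rewrite f0// g0// mulr0 addr0.
Qed.

Lemma test_funM f g : test f -> test g -> test (f * g).
Proof.
move=> [/smoothP sf [K [cK KO f0]]] [/smoothP sg _]; split.
  by apply/smoothP; exact: smoothM.
exists K; split => // x Kx; rewrite (_ : (f * g) x = f x * g x)//.
by rewrite f0// mul0r.
Qed.

Lemma compact_row_closed (K : set 'rV[R]_d) : compact K -> closed K.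
Proof. by apply: compact_closed; exact: norm_hausdorff. Qed.

Lemma test_fun_partial f i : test f -> test (fun x => 'D_'e_i f x).
Proof.
move=> [/smoothP sf [K [cK KO f0]]]; split.
  by apply/smoothP; exact: smooth_partial.
exists K; split => //; apply: derive_support => //.
exact: compact_row_closed.
Qed.

Lemma test_fun_box f : test f -> exists r, forall x, ~ row_box d r x -> f x = 0.
Proof.
move=> [_ [K [/compact_bounded[M [_ HM]] _ f0]]].
exists (`|M| + 1) => x xr; apply: f0; apply: contra_not xr => Kx i.
have := HM (`|M| + 1) _ x Kx; rewrite ltr_pwDr ?ler_norm// => /(_ isT).
by apply: le_trans; rewrite /Num.norm /= mx_normrE; apply: (le_bigmax _ _ (ord0, i)).
Qed.

Lemma test_fun_continuous f : test f -> continuous f.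
Proof. by move=> /test_fun_smooth[/(_ [::])]. Qed.

Lemma test_fun_derivable f i x : test f -> derivable f x 'e_i.
Proof. by move=> /test_fun_smooth[_ /(_ [::])]. Qed.

Lemma test_fun_rinteg f : test f -> rinteg mu setT f.
Proof.
move=> tf; have [r fr] := test_fun_box tf.
exact: continuous_support_integrable (test_fun_continuous tf) fr.
Qed.

Lemma test_fun_sq_integrable f : test f -> L2 f.
Proof.
move=> tf; split.
  by apply: measurable_funTS; apply: continuous_row_measurable; exact: test_fun_continuous.
apply: (@integrableS _ _ _ _ setT) => //.
have := test_fun_rinteg (test_funM tf tf).
by apply: rinteg_ext => // x _; rewrite expr2.
Qed.

Lemma integral_partial_test f i : test f -> \int[mu]_(x in Om) ('D_'e_i f x) = 0.
Proof.
move=> tf; rewrite /Rintegral integral_mkcond.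
have [r fr] := test_fun_box tf; have [_ [K [_ KO f0]]] := test_fun_partial i tf.
(* The derivative is supported in a compact subset of [Om], so the integral may be taken over the
   whole space. *)
rewrite (_ : integral _ _ _ = \int[mu]_x ('D_'e_i f x)%:E)%E; last first.
  apply: eq_integral => x _; rewrite patchE; case: ifPn => //.
  by rewrite notin_setE => xO; rewrite f0// => /KO.
rewrite (@integral_partial_eq0 _ _ _ _ r)//; first exact: test_fun_continuous.
  by move=> x; exact: test_fun_derivable.
by apply: test_fun_continuous; exact: test_fun_partial.
Qed.

(** Integrate the product rule for [f * g], which is itself a test function, so that the total
    integral is 0. *)
Lemma test_fun_weak_gradient f : test f ->
  weak_gradient Om f (fun x => \row_i 'D_'e_i f x).
Proof.
move=> tf i g tg; apply/eqP; rewrite -subr_eq0 opprK; apply/eqP.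
rewrite -(integral_partial_test i (test_funM tf tg)).
rewrite -RintegralD//; last 2 first.
- by apply: sq_integrableM => //; apply: test_fun_sq_integrable => //; exact: test_fun_partial.
- apply: (rinteg_ext mOm) (sq_integrableM mOm (test_fun_sq_integrable (test_fun_partial i tf))
    (test_fun_sq_integrable tg)) => x _; by rewrite mxE.
apply: eq_Rintegral => x _; rewrite deriveM ?mxE; [|exact: test_fun_derivable..].
by congr (_ + _); rewrite mulrC.
Qed.

End test_functions.

(** * Weak gradients *)

Local Notation coord := Defs.coord.

Section H10.
Context {R : realType} {d : nat} (Om : set 'rV[R]_d).
Hypothesis oOm : open Om.
Local Notation mu := (lebesgue_row R d).
Local Notation test := (test_fun Om).
Local Notation L2 := (sq_integrable mu Om).
Local Notation a := (ipL2 mu Om).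

Let mOm : measurable Om. Proof. exact: open_row_measurable. Qed.
Let L2lin : linear_set L2. Proof. exact: sq_integrable_linear. Qed.
Let asi : semi_inner L2 a. Proof. exact: ipL2_semi_inner. Qed.

Lemma ipL2_ae p p' q : L2 p -> L2 p' -> L2 q -> ae_eq mu Om p p' -> a p q = a p' q.
Proof.
move=> hp hp' hq e; apply: Rintegral_ae => //.
- exact: rinteg_measurable (sq_integrableM mOm hp hq).
- exact: rinteg_measurable (sq_integrableM mOm hp' hq).
- by apply: filterS e => x h Dx; rewrite h.
Qed.

(** The parallelogram identity with one term dropped. It serves as a triangle inequality for squared
    distances, the form in which H^1 approximation is stated. *)
Lemma ipL2_sqr_linD (k : R) p q : L2 p -> L2 q ->
  a (k *: p + q) (k *: p + q) <= 2 * k ^+ 2 * a p p + 2 * a q q.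
Proof.
move=> hp hq; have hk := @linear_setZ _ _ _ L2lin k _ hp.
have := semi_inner_ge0 asi (linear_setB L2lin hk hq).
rewrite (semi_inner_sqrB L2lin asi hk hq) (semi_inner_sqrD L2lin asi hk hq).
by rewrite (semi_inner_sqrZ L2lin asi k hp); lra.
Qed.

Lemma L2_test phi : test phi -> L2 phi.
Proof. exact: test_fun_sq_integrable. Qed.

Lemma L2_partial_test phi i : test phi -> L2 ('D_'e_i phi).
Proof. by move=> t; apply: L2_test; exact: test_fun_partial. Qed.

Lemma weak_gradient_ip p g : weak_gradient Om p g <->
  forall i phi, test phi -> a p ('D_'e_i phi) = - a (coord g i) phi.
Proof. by []. Qed.

Lemma H10_gradientP p g : H10_gradient Om p g <->
  [/\ L2 p, forall i, L2 (coord g i),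
    forall i phi, test phi -> a p ('D_'e_i phi) = - a (coord g i) phi &
    forall e : R, 0 < e -> exists2 phi, test phi &
      a (p - phi) (p - phi) +
      \sum_(i < d) a (coord g i - 'D_'e_i phi) (coord g i - 'D_'e_i phi) < e].
Proof.
by split=> -[hp hg wg he]; split.
Qed.

Lemma coord_lin (k : R) (v w : 'rV[R]_d -> 'rV[R]_d) j :
  coord (k *: v + w) j = k *: coord v j + coord w j.
Proof. by apply/funext => x; rewrite /coord !mxE. Qed.

Lemma coordB (v w : 'rV[R]_d -> 'rV[R]_d) j : coord (v - w) j = coord v j - coord w j.
Proof. by apply/funext => x; rewrite /coord !mxE. Qed.

Lemma derive_test_lin (k : R) phi psi i : test phi -> test psi ->
  'D_'e_i (k *: phi + psi) = k *: 'D_'e_i phi + 'D_'e_i psi.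
Proof.
move=> /test_fun_smooth t1 /test_fun_smooth t2.
exact: (iter_partial_lin k [:: i] t1 t2).
Qed.

Lemma H10_gradient_lin (k : R) p q g h : H10_gradient Om p g -> H10_gradient Om q h ->
  H10_gradient Om (k *: p + q) (k *: g + h).
Proof.
move=> /H10_gradientP[hp hg wg pe] /H10_gradientP[hq hh wh qe]; apply/H10_gradientP.
have hL i : L2 (coord (k *: g + h) i) by rewrite coord_lin; exact: L2lin.2.
split=> //; first exact: L2lin.2.
  move=> i phi tphi; rewrite coord_lin.
  have [lin _ _] := asi.
  rewrite (lin _ (L2_partial_test i tphi))// (lin _ (L2_test tphi))//.
  by rewrite wg// wh//; ring.
(* [c] dominates [2 * k ^+ 2] and stays positive when [k = 0]; each of the two approximations then
   contributes less than [e / 2]. *)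
move=> e e0; pose c := 2 * (k ^+ 2 + 1).
have c0 : 0 < c by rewrite mulr_gt0// ltr_wpDl// sqr_ge0.
have [phi tphi phie] := pe (e / (2 * c)) ltac:(by rewrite divr_gt0// mulr_gt0).
have [psi tpsi psie] := qe (e / 4) ltac:(by rewrite divr_gt0).
have ttest := (test_fun_linear Om).2 k _ _ tphi tpsi.
exists (k *: phi + psi) => //.
pose A := a (p - phi) (p - phi); pose A' := a (q - psi) (q - psi).
pose B := \sum_(i < d) a (coord g i - 'D_'e_i phi) (coord g i - 'D_'e_i phi).
pose B' := \sum_(i < d) a (coord h i - 'D_'e_i psi) (coord h i - 'D_'e_i psi).
rewrite -/A -/B in phie; rewrite -/A' -/B' in psie.
have lin2 (x y z w : 'rV[R]_d -> R) : k *: x + y - (k *: z + w) = k *: (x - z) + (y - w).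
  by rewrite scalerBr opprD addrACA.
apply: (@le_lt_trans _ _ (2 * k ^+ 2 * (A + B) + 2 * (A' + B'))).
  rewrite lin2 !mulrDr addrACA lerD//.
    by apply: ipL2_sqr_linD; apply: linear_setB => //; exact: L2_test.
  rewrite !mulr_sumr -big_split /=; apply: ler_sum => i _.
  rewrite coord_lin derive_test_lin// lin2.
  by apply: ipL2_sqr_linD; apply: linear_setB => //; exact: L2_partial_test.
have AB0 : 0 <= A + B.
  rewrite addr_ge0 ?sumr_ge0// => [|i _]; apply: (semi_inner_ge0 asi);
    apply: linear_setB => //; [exact: L2_test|exact: L2_partial_test].
have : c * (A + B) < e / 2.
  rewrite mulrC -ltr_pdivlMr// (_ : e / 2 / c = e / (2 * c)) //.
  by field; rewrite gt_eqF.
by move: psie; rewrite /c; nra.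
Qed.

(* By definition of H10_gradient, g is an L^2 limit of the fields grad phi_n, whose
   components are test functions; being orthogonal to all test functions, g is
   orthogonal to itself. *)
Lemma H10_gradient_null p g : H10_gradient Om p g -> ae_eq mu Om p (fun=> 0) ->
  forall i, ae_eq mu Om (coord g i) (fun=> 0).
Proof.
move=> /H10_gradientP[hp hg wg pe] p0 i; apply: ipL2_eq0_ae => //.
have L20 : L2 0 by exact: linear_set0.
have orth phi : test phi -> a (coord g i) phi = 0.
  move=> tphi; have := wg i _ tphi.
  rewrite (@ipL2_ae _ 0)//; last exact: L2_partial_test.
  have [lin _ _] := asi.
  rewrite (linear_on0 L2lin (lin _ (L2_partial_test i tphi))).
  by move=> /eqP; rewrite eq_sym oppr_eq0 => /eqP.
apply/eqP; rewrite eq_le (semi_inner_ge0 asi)// andbT.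
apply/ler_addgt0Pl => e e0; rewrite addr0.
have [phi tphi phie] := pe _ e0.
have tD := test_fun_partial i tphi.
have hD := L2_partial_test i tphi.
have hB := linear_setB L2lin (hg i) hD.
have : a (coord g i) (coord g i) = a (coord g i) (coord g i - 'D_'e_i phi).
  by rewrite (semi_innerBr L2lin asi)// (orth ('D_'e_i phi))// subr0.
have := cauchy_schwarz L2lin asi (hg i) hB.
have : a (coord g i - 'D_'e_i phi) (coord g i - 'D_'e_i phi) < e.
  apply: le_lt_trans phie; rewrite (bigD1 i)//= addrCA lerDl.
  rewrite addr_ge0 ?sumr_ge0// => [|j _]; apply: (semi_inner_ge0 asi);
    apply: linear_setB => //; [exact: L2_test|exact: L2_partial_test].
have := semi_inner_ge0 asi (hg i).
move=> x0 ye h e1; rewrite -e1 in h; set x := a (coord g i) (coord g i) in x0 h *.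
have [->|xn] := eqVneq x 0; first exact: ltW.
have xp : 0 < x by rewrite lt_neqAle eq_sym xn.
by move: h; rewrite expr2 ler_pM2l// => /le_lt_trans/(_ ye)/ltW.
Qed.

Lemma H10_gradient_unique p q g h : H10_gradient Om p g -> H10_gradient Om q h ->
  ae_eq mu Om p q -> forall i, ae_eq mu Om (coord g i) (coord h i).
Proof.
move=> Hp Hq pq i; have := H10_gradient_null (H10_gradient_lin (-1) Hq Hp).
have z : ae_eq mu Om (-1 *: q + p) (fun=> 0).
  apply: filterS pq => x h1 Dx; rewrite (_ : (-1 *: q + p) x = -1 * q x + p x)//.
  by rewrite h1// mulN1r addNr.
move=> /(_ z i); apply: filterS => x h1 /h1; rewrite /coord !mxE mulN1r => /eqP.
by rewrite addr_eq0 eqr_opp => /eqP.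
Qed.

Lemma H10_grad p : H10 Om p -> H10_gradient Om p (grad Om p).
Proof. by move=> [g Hg]; rewrite /grad; case: xgetP => [? ->//|/(_ g)]. Qed.

Lemma grad_ae p g i : H10_gradient Om p g ->
  ae_eq mu Om (coord (grad Om p) i) (coord g i).
Proof.
move=> Hp; have Hq : H10 Om p by exists g.
by apply: (H10_gradient_unique (H10_grad Hq) Hp); exact: ae_eq_refl.
Qed.

Lemma H10_gradient_test phi : test phi ->
  H10_gradient Om phi (fun x => \row_i 'D_'e_i phi x).
Proof.
move=> tphi; have e i : coord (fun x => \row_i 'D_'e_i phi x) i = 'D_'e_i phi.
  by apply/funext => x; rewrite /coord mxE.
apply/H10_gradientP; split.
- exact: L2_test.
- by move=> i; rewrite e; exact: L2_partial_test.
- by move=> i psi tpsi; apply: (test_fun_weak_gradient oOm tphi i tpsi).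
- move=> eps eps0; exists phi => //.
  have a0 : a 0 0 = 0.
    by have := semi_inner_sqrZ L2lin asi 0 (linear_set0 L2lin); rewrite scale0r expr0n mul0r.
  by rewrite subrr a0 big1 ?addr0// => i _; rewrite e subrr a0.
Qed.

(** The weak identity passes to L^2 limits by Cauchy-Schwarz, and approximability by test functions
    passes by the triangle inequality. Completeness of [spaceX] rests on this closedness of the
    gradient. *)
Lemma H10_gradient_closed p g : L2 p -> (forall i, L2 (coord g i)) ->
  (forall e : R, 0 < e -> exists q h, H10_gradient Om q h /\
    a (p - q) (p - q) + \sum_(i < d) a (coord g i - coord h i) (coord g i - coord h i) < e) ->
  H10_gradient Om p g.
Proof.
move=> hp hg he; apply/H10_gradientP; split => //.
  move=> i phi tphi; apply/eqP; rewrite -subr_eq0 -normr_le0.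
  apply/ler_addgt0Pl => e e0; rewrite addr0.
  have hphi := L2_test tphi; have hD := L2_partial_test i tphi.
  (* The defect in the weak identity is at most [e / c] times the sum of the norms of [phi] and its
     derivative; the 1 keeps [c] positive. *)
  pose N := semi_norm a; pose c := N phi + N ('D_'e_i phi) + 1.
  have c0 : 0 < c by rewrite ltr_wpDl// addr_ge0// semi_norm_ge0.
  have [q [h [/H10_gradientP[hq hh wq _] lt]]] := he ((e / c) ^+ 2)
    ltac:(by rewrite exprn_gt0// divr_gt0).
  have hpq := linear_setB L2lin hp hq; have hgh := linear_setB L2lin (hg i) (hh i).
  have small r : L2 r -> a r r < (e / c) ^+ 2 -> N r <= e / c.
    move=> hr rr; rewrite -(@ler_pXn2r _ 2) ?nnegrE ?semi_norm_ge0//.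
      by rewrite (sqr_semi_norm asi)// ltW.
    by rewrite divr_ge0// ltW.
  have S0 : 0 <= \sum_(j < d) a (coord g j - coord h j) (coord g j - coord h j).
    by rewrite sumr_ge0// => j _; apply: (semi_inner_ge0 asi); apply: linear_setB.
  have n1 : N (p - q) <= e / c.
    by apply: small => //; apply: le_lt_trans lt; rewrite lerDl.
  have n2 : N (coord g i - coord h i) <= e / c.
    apply: small => //; apply: le_lt_trans lt; rewrite (bigD1 i)//= addrCA lerDl addr_ge0//.
      exact: (semi_inner_ge0 asi).
    by rewrite sumr_ge0// => j _; apply: (semi_inner_ge0 asi); apply: linear_setB.
  have -> : a p ('D_'e_i phi) - - a (coord g i) phi =
     a (p - q) ('D_'e_i phi) + a (coord g i - coord h i) phi.
    by rewrite !(semi_innerBl L2lin asi)// wq//; ring.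
  apply: le_trans (ler_normD _ _) _.
  have := cauchy_schwarz_norm L2lin asi hpq hD; rewrite -/N => h1.
  have := cauchy_schwarz_norm L2lin asi hgh hphi; rewrite -/N => h2.
  have : e / c * c = e by rewrite mulfVK// gt_eqF.
  have p1 : 0 <= N phi by exact: semi_norm_ge0.
  have p2 : 0 <= N ('D_'e_i phi) by exact: semi_norm_ge0.
  have : 0 <= e / c by rewrite divr_ge0// ltW.
  have h3 : N (p - q) * N ('D_'e_i phi) <= e / c * N ('D_'e_i phi) by rewrite ler_wpM2r.
  have h4 : N (coord g i - coord h i) * N phi <= e / c * N phi by rewrite ler_wpM2r.
  by rewrite /c; move: (e / _) h3 h4 => t; lra.
move=> e e0; have [q [h [/H10_gradientP[hq hh _ qe] lt]]] := he (e / 4) ltac:(by rewrite divr_gt0).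
have [phi tphi lt2] := qe (e / 4) ltac:(by rewrite divr_gt0).
exists phi => //.
have tri (x y z : 'rV[R]_d -> R) : L2 x -> L2 y -> L2 z ->
    a (x - z) (x - z) <= 2 * a (x - y) (x - y) + 2 * a (y - z) (y - z).
  move=> hx hy hz; have -> : x - z = 1 *: (x - y) + (y - z) by rewrite scale1r addrA subrK.
  have := @ipL2_sqr_linD 1 _ _ (linear_setB L2lin hx hy) (linear_setB L2lin hy hz).
  by rewrite expr1n mulr1.
have h1 := tri p q phi hp hq (L2_test tphi).
have h2 : \sum_(i < d) a (coord g i - 'D_'e_i phi) (coord g i - 'D_'e_i phi) <=
  2 * \sum_(i < d) a (coord g i - coord h i) (coord g i - coord h i) +
  2 * \sum_(i < d) a (coord h i - 'D_'e_i phi) (coord h i - 'D_'e_i phi).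
  rewrite !mulr_sumr -big_split /=; apply: ler_sum => i _.
  by apply: tri => //; exact: L2_partial_test.
by move: lt lt2 h1 h2; lra.
Qed.

End H10.

(** * Vector fields *)

Lemma eventually_small_sum (R : realType) (J : finType) (u : J -> nat -> R) :
  (forall j (e : R), 0 < e -> exists N, forall n, (N <= n)%N -> u j n < e) ->
  forall e : R, 0 < e -> exists N, forall n, (N <= n)%N -> \sum_j u j n < e.
Proof.
move=> hu e e0; pose e' := e / #|J|.+1%:R.
have e'0 : 0 < e' by rewrite divr_gt0.
have [N HN] := choice (fun j => hu j e' e'0).
exists (\max_j N j)%N => n Nn.
apply: (@le_lt_trans _ _ (\sum_(j : J) e')).
  apply: ler_sum => j _; apply/ltW/HN; apply: leq_trans Nn; exact: leq_bigmax.
rewrite sumr_const -mulr_natr /e' -mulrA gtr_pMr// mulrC ltr_pdivrMr//.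
by rewrite mul1r ltr_nat.
Qed.

Section fields.
Context {R : realType} {d : nat} (Om : set 'rV[R]_d).
Hypothesis oOm : open Om.
Local Notation mu := (lebesgue_row R d).
Local Notation L2 := (sq_integrable mu Om).
Local Notation a := (ipL2 mu Om).
Local Notation X := (spaceX Om : set ('rV[R]_d -> 'rV[R]_d)).
Local Notation V := (spaceV Om : set ('rV[R]_d -> 'rV[R]_d)).
Local Notation ipg := (ip_grad Om).

Let mOm : measurable Om. Proof. exact: open_row_measurable. Qed.
Let L2lin : linear_set L2. Proof. exact: sq_integrable_linear. Qed.
Let asi : semi_inner L2 a. Proof. exact: ipL2_semi_inner. Qed.

Lemma spaceX_gradient v j : X v -> H10_gradient Om (coord v j) (grad Om (coord v j)).
Proof. by move=> Xv; apply: H10_grad; exact: Xv. Qed.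

Lemma spaceX_L2 v : X v -> L2_field Om v.
Proof. by move=> Xv j; have [] := spaceX_gradient j Xv. Qed.

Lemma partial_L2 v i j : X v -> L2 (partial Om v i j).
Proof. by move=> Xv; have [_ + _ _] := spaceX_gradient j Xv; apply. Qed.

Lemma spaceX_linear : linear_set X.
Proof.
split=> [j|k v w Xv Xw j].
  have -> : coord 0 j = 0 :> ('rV[R]_d -> R) by apply/funext => x; rewrite /coord mxE.
  have := H10_gradient_test oOm (linear_set0 (test_fun_linear Om)).
  by move=> h; eexists; exact: h.
rewrite coord_lin; eexists.
exact: (H10_gradient_lin oOm k (spaceX_gradient j Xv) (spaceX_gradient j Xw)).
Qed.

(** The identity is almost everywhere because [grad] picks a representative separately for each
    function. *)
Lemma partial_lin (k : R) v w i j : X v -> X w ->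
  ae_eq mu Om (partial Om (k *: v + w) i j) (k *: partial Om v i j + partial Om w i j).
Proof.
move=> Xv Xw; rewrite /partial coord_lin.
have := H10_gradient_lin oOm k (spaceX_gradient j Xv) (spaceX_gradient j Xw).
by move=> /(grad_ae oOm i); apply: filterS => x h /h; rewrite /coord => ->; rewrite !mxE.
Qed.

Lemma ip_gradE v w : X v -> X w ->
  ipg v w = \sum_(i < d) \sum_(j < d) a (partial Om v i j) (partial Om w i j).
Proof.
move=> Xv Xw; have r i j : rinteg mu Om (fun x => partial Om v i j x * partial Om w i j x).
  by apply: sq_integrableM => //; exact: partial_L2.
rewrite /ip_grad Rintegral_sum//; last by move=> i; exact: rinteg_sum.
by apply: eq_bigr => i _; rewrite Rintegral_sum.
Qed.

Lemma ip_grad_semi_inner : semi_inner X ipg.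
Proof.
have [lin _ _] := asi.
split=> [z Xz k v w Xv Xw|v w Xv Xw|v Xv].
- have Xkv := spaceX_linear.2 k _ _ Xv Xw.
  rewrite (ip_gradE Xkv Xz) (ip_gradE Xv Xz) (ip_gradE Xw Xz) mulr_sumr -big_split /=.
  apply: eq_bigr => i _.
  rewrite mulr_sumr -big_split /=; apply: eq_bigr => j _.
  have hz := partial_L2 i j Xz; have hv := partial_L2 i j Xv; have hw := partial_L2 i j Xw.
  rewrite -(lin _ hz)//; apply: ipL2_ae => //; first exact: partial_L2.
    exact: L2lin.2.
  exact: partial_lin.
- rewrite (ip_gradE Xv Xw) (ip_gradE Xw Xv); apply: eq_bigr => i _; apply: eq_bigr => j _.
  by apply: (semi_inner_sym asi); exact: partial_L2.
- rewrite ip_gradE//; apply: sumr_ge0 => i _; apply: sumr_ge0 => j _.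
  by apply: (semi_inner_ge0 asi); exact: partial_L2.
Qed.

Lemma partial_le_ip_grad v i j : X v -> a (partial Om v i j) (partial Om v i j) <= ipg v v.
Proof.
move=> Xv; rewrite ip_gradE// (bigD1 i)//= (bigD1 j)//= -addrA lerDl addr_ge0//.
  by apply: sumr_ge0 => l _; apply: (semi_inner_ge0 asi); exact: partial_L2.
apply: sumr_ge0 => k _; apply: sumr_ge0 => l _.
by apply: (semi_inner_ge0 asi); exact: partial_L2.
Qed.

Lemma L2_field_linear : linear_set (L2_field Om : set ('rV[R]_d -> 'rV[R]_d)).
Proof.
split=> [j|k v w hv hw j]; last by rewrite coord_lin; apply: L2lin.2; [exact: hv|exact: hw].
have -> : coord 0 j = 0 :> ('rV[R]_d -> R) by apply/funext => x; rewrite /coord mxE.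
exact: linear_set0.
Qed.

Lemma ipE v w : L2_field Om v -> L2_field Om w ->
  ip Om v w = \sum_(j < d) a (coord v j) (coord w j).
Proof.
move=> hv hw; rewrite /ip Rintegral_sum// => j.
by apply: (@sq_integrableM _ _ _ _ _ mOm (coord v j) (coord w j)); [exact: hv|exact: hw].
Qed.

Lemma ip_semi_inner : semi_inner (L2_field Om : set ('rV[R]_d -> 'rV[R]_d)) (ip Om).
Proof.
have [lin _ _] := asi.
split=> [z hz k v w hv hw|v w hv hw|v hv].
- have hkv := L2_field_linear.2 k _ _ hv hw.
  rewrite (ipE hkv hz) (ipE hv hz) (ipE hw hz) mulr_sumr -big_split /=; apply: eq_bigr => j _.
  by rewrite coord_lin; apply: (lin _ (hz j)); [exact: hv|exact: hw].
- rewrite (ipE hv hw) (ipE hw hv); apply: eq_bigr => j _.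
  by apply: (semi_inner_sym asi); [exact: hv|exact: hw].
- by rewrite ipE//; apply: sumr_ge0 => j _; apply: (semi_inner_ge0 asi); exact: hv.
Qed.

Lemma coord_le_ip v j : L2_field Om v -> a (coord v j) (coord v j) <= ip Om v v.
Proof.
move=> hv; rewrite ipE// (bigD1 j)//= lerDl.
by apply: sumr_ge0 => l _; apply: (semi_inner_ge0 asi); exact: hv.
Qed.

Lemma ip_eq0_ae v : L2_field Om v -> ip Om v v = 0 -> ae_eq mu Om v (fun=> 0).
Proof.
move=> hv v0.
have h j : ae_eq mu Om (coord v j) (fun=> 0).
  apply: ipL2_eq0_ae => //; first exact: hv.
  apply/eqP; rewrite eq_le -{1}v0 coord_le_ip//= .
  by apply: (semi_inner_ge0 asi); exact: hv.
have : {ae mu, forall x, forall j, Om x -> coord v j x = 0}.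
  by apply: filter_forall => j; exact: h.
apply: filterS => x hx Dx; apply/rowP => j; rewrite mxE.
exact: hx.
Qed.

Lemma div_L2 v : X v -> L2 (div Om v).
Proof.
move=> Xv; rewrite (_ : div Om v = \sum_(i < d) partial Om v i i); last first.
  by apply/funext => x; rewrite /div fct_sumE.
elim/big_ind : _; first exact: linear_set0.
  by move=> p q; exact: linear_setD.
by move=> i _; exact: partial_L2.
Qed.

(** Continuity of the divergence for the gradient norm, which makes the constraint defining [spaceV]
    closed. *)
Lemma div_norm v : X v -> semi_norm a (div Om v) <= d%:R * semi_norm ipg v.
Proof.
move=> Xv; rewrite (_ : div Om v = \sum_(i < d) partial Om v i i); last first.
  by apply/funext => x; rewrite /div fct_sumE.
have : L2 (\sum_(i < d) partial Om v i i) /\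
  semi_norm a (\sum_(i < d) partial Om v i i) <= \sum_(i < d) semi_norm ipg v.
  elim/big_ind2 : _ => [|p x q y [hp px] [hq qy]|i _].
  - by split; [exact: linear_set0|rewrite (semi_norm0 L2lin asi)].
  - split; first exact: linear_setD.
    by apply: le_trans (semi_normD L2lin asi hp hq) _; exact: lerD.
  - split; first exact: partial_L2.
    by apply: ler_wsqrtr; exact: partial_le_ip_grad.
by move=> [_]; rewrite sumr_const card_ord -[_ *+ d]mulr_natl.
Qed.

Lemma div_lin (k : R) v w : X v -> X w ->
  ae_eq mu Om (div Om (k *: v + w)) (k *: div Om v + div Om w).
Proof.
move=> Xv Xw.
have : {ae mu, forall x, forall i, Om x -> partial Om (k *: v + w) i i x =
    (k *: partial Om v i i + partial Om w i i) x}.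
  by apply: filter_forall => i; exact: partial_lin.
apply: filterS => x h Dx; rewrite /div (_ : (_ + _) x =
   k * \sum_(i < d) partial Om v i i x + \sum_(i < d) partial Om w i i x)//.
by rewrite mulr_sumr -big_split /=; apply: eq_bigr => i _; rewrite h.
Qed.

Lemma spaceV_linear : linear_set V.
Proof.
split=> [|k v w [Xv dv] [Xw dw]].
  split; first exact: linear_set0 spaceX_linear.
  have X0 := linear_set0 spaceX_linear.
  have := div_lin (-1) X0 X0; rewrite scaler0 addr0.
  by apply: filterS => x h /h ->; rewrite (_ : (_ + _) x = -1 * div Om 0 x + div Om 0 x)//
    mulN1r addNr.
split; first exact: spaceX_linear.2.
have := div_lin k Xv Xw; move: dv dw; apply: filterS3 => x h1 h2 h3 Dx.
by rewrite h3// (_ : (_ + _) x = k * div Om v x + div Om w x)// h1// h2// mulr0 addr0.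
Qed.

Section complete.
Context (CP : R) (hCP : poincare_constant Om CP).

Lemma poincare_sqr v : X v -> ip Om v v <= CP ^+ 2 * ipg v v.
Proof.
move=> Xv; have := hCP Xv => h.
have hv := spaceX_L2 Xv.
rewrite -(sqr_semi_norm ip_semi_inner hv) -(sqr_semi_norm ip_grad_semi_inner Xv) -exprMn.
rewrite ler_pXn2r ?nnegrE ?semi_norm_ge0//.
by apply: le_trans h; exact: semi_norm_ge0.
Qed.

(** The components are Cauchy in L^2 by the Poincaré inequality, and the partial derivatives because
    each is dominated by the gradient norm. Closedness of the weak gradient identifies the limits of
    the latter as derivatives of the limits of the former. *)
Lemma spaceX_complete : complete_for X ipg.
Proof.
move=> s Xs sC; have Xlin := spaceX_linear.
have sB m n : X (s m - s n) by exact: (linear_setB Xlin).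
have cC j (e : R) : 0 < e -> exists N, forall m n, (N <= m)%N -> (N <= n)%N ->
    a (coord (s m) j - coord (s n) j) (coord (s m) j - coord (s n) j) < e.
  move=> e0; have c0 : 0 < CP ^+ 2 + 1 by rewrite ltr_wpDl// sqr_ge0.
  have [|N HN] := sC (e / (CP ^+ 2 + 1)); first by rewrite divr_gt0.
  exists N => m n Nm Nn; rewrite -coordB.
  apply: le_lt_trans (coord_le_ip j (spaceX_L2 (sB m n))) _.
  apply: le_lt_trans (poincare_sqr (sB m n)) _.
  have := HN _ _ Nm Nn; rewrite ltr_pdivlMr// mulrC; apply: le_lt_trans.
  by rewrite ler_wpM2r ?lerDl// (semi_inner_ge0 ip_grad_semi_inner).
have pB v w i j : X v -> X w ->
    ae_eq mu Om (partial Om (v - w) i j) (partial Om v i j - partial Om w i j).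
  move=> Xv Xw; have := partial_lin (-1) i j Xw Xv.
  rewrite scaleN1r addrC; apply: filterS => x h /h ->.
  by rewrite (_ : (_ + _) x = -1 * partial Om w i j x + partial Om v i j x)// mulN1r addrC.
have apB v w i j : X v -> X w -> a (partial Om (v - w) i j) (partial Om (v - w) i j) =
    a (partial Om v i j - partial Om w i j) (partial Om v i j - partial Om w i j).
  move=> Xv Xw; have h1 := partial_L2 i j (linear_setB Xlin Xv Xw).
  have h2 := linear_setB L2lin (partial_L2 i j Xv) (partial_L2 i j Xw).
  rewrite (ipL2_ae oOm h1 h2 h1 (pB v w i j Xv Xw)).
  rewrite (semi_inner_sym asi)//.
  by rewrite (ipL2_ae oOm h1 h2 h2 (pB v w i j Xv Xw)).
have pC i j (e : R) : 0 < e -> exists N, forall m n, (N <= m)%N -> (N <= n)%N ->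
    a (partial Om (s m) i j - partial Om (s n) i j)
      (partial Om (s m) i j - partial Om (s n) i j) < e.
  move=> e0; have [N HN] := sC _ e0.
  exists N => m n Nm Nn; rewrite -apB//; apply: le_lt_trans (HN _ _ Nm Nn).
  exact: partial_le_ip_grad.
have cL j : exists l, L2 l /\ forall e : R, 0 < e -> exists N, forall n, (N <= n)%N ->
    a (coord (s n) j - l) (coord (s n) j - l) < e.
  have [||l hl Hl] := @sq_integrable_complete _ _ _ mu _ mOm (fun n => coord (s n) j).
  - by move=> n; exact: (spaceX_L2 (Xs n)).
  - exact: cC.
  - by exists l.
have pL (ij : 'I_d * 'I_d) : exists l, L2 l /\ forall e : R, 0 < e ->
    exists N, forall n, (N <= n)%N ->
    a (partial Om (s n) ij.1 ij.2 - l) (partial Om (s n) ij.1 ij.2 - l) < e.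
  have [||l hl Hl] := @sq_integrable_complete _ _ _ mu _ mOm
      (fun n => partial Om (s n) ij.1 ij.2).
  - by move=> n; exact: partial_L2.
  - exact: pC.
  - by exists l.
have [l Hl] := choice cL; have [g Hg] := choice pL.
pose L : 'rV[R]_d -> 'rV[R]_d := fun x => \row_j l j x.
pose G j : 'rV[R]_d -> 'rV[R]_d := fun x => \row_i g (i, j) x.
have LE j : coord L j = l j by apply/funext => x; rewrite /coord mxE.
have GE i j : coord (G j) i = g (i, j) by apply/funext => x; rewrite /coord mxE.
have symB p q : L2 p -> L2 q -> a (p - q) (p - q) = a (q - p) (q - p).
  move=> hp hq; rewrite -(sqr_semi_norm asi (linear_setB L2lin hp hq)).
  by rewrite (semi_norm_dist_sym L2lin asi)// (sqr_semi_norm asi)//; exact: linear_setB.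
have HL j : H10_gradient Om (coord L j) (G j).
  apply: H10_gradient_closed => //.
  - by rewrite LE; exact: (Hl j).1.
  - by move=> i; rewrite GE; exact: (Hg _).1.
  move=> e e0; have e20 : 0 < e / 2 by rewrite divr_gt0.
  have [N1 HN1] := (Hl j).2 _ e20.
  have [N2 HN2] := @eventually_small_sum R 'I_d (fun i n =>
    a (partial Om (s n) i j - g (i, j)) (partial Om (s n) i j - g (i, j)))
    (fun i => (Hg (i, j)).2) _ e20.
  pose N := maxn N1 N2.
  exists (coord (s N) j), (grad Om (coord (s N) j)); split.
    exact: spaceX_gradient.
  rewrite LE symB; [|exact: (Hl j).1|exact: (spaceX_L2 (Xs N))].
  rewrite (eq_bigr (fun i => a (partial Om (s N) i j - g (i, j))
    (partial Om (s N) i j - g (i, j)))); last first.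
    move=> i _; rewrite GE symB//; first exact: (Hg _).1.
    exact: (partial_L2 i j (Xs N)).
  by have := HN1 _ (leq_maxl N1 N2); have := HN2 _ (leq_maxr N1 N2); rewrite -/N; lra.
have XL : X L by move=> j; exists (G j).
exists L => // e e0.
have gE i j : ae_eq mu Om (partial Om L i j) (g (i, j)).
  by rewrite -GE; exact: (grad_ae oOm i (HL j)).
have [N HN] := @eventually_small_sum R ('I_d * 'I_d)%type (fun ij n =>
    a (partial Om (s n) ij.1 ij.2 - g ij) (partial Om (s n) ij.1 ij.2 - g ij))
    (fun ij => (Hg ij).2) _ e0.
exists N => n Nn; apply: le_lt_trans (HN _ Nn).
have Xd := linear_setB Xlin (Xs n) XL; rewrite (ip_gradE Xd Xd).
rewrite pair_bigA /= le_eqVlt; apply/orP; left; apply/eqP.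
apply: eq_bigr => -[i j] _ /=; rewrite apB//.
have h0 := partial_L2 i j (Xs n).
have h1 := linear_setB L2lin h0 (partial_L2 i j XL).
have h2 := linear_setB L2lin h0 (Hg (i, j)).1.
have e12 : ae_eq mu Om (partial Om (s n) i j - partial Om L i j)
   (partial Om (s n) i j - g (i, j)).
  apply: filterS (gE i j) => x h Dx.
  rewrite (_ : (partial Om (s n) i j - partial Om L i j) x =
    partial Om (s n) i j x - partial Om L i j x)//.
  by rewrite h.
rewrite (ipL2_ae oOm h1 h2 h1 e12) (semi_inner_sym asi)//.
by rewrite (ipL2_ae oOm h1 h2 h2 e12).
Qed.

(** The fields [s N] have null divergence, so the divergence of the limit [l] has the same norm as
    that of [s N - l], which tends to 0. *)
Lemma spaceV_complete : complete_for V ipg.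
Proof.
move=> s Vs sC; have Xs n : X (s n) by case: (Vs n).
have Xlin := spaceX_linear.
have [l Xl sl] := spaceX_complete Xs sC.
exists l => //; split => //.
have hl := div_L2 Xl; apply: ipL2_eq0_ae => //.
rewrite -(sqr_semi_norm asi hl); apply/eqP; rewrite sqrf_eq0 eq_le semi_norm_ge0 andbT.
apply/ler_addgt0Pl => e e0; rewrite addr0.
pose e1 := e / d.+1%:R; have e10 : 0 < e1 by rewrite divr_gt0.
have [|N HN] := sl (e1 ^+ 2); first by rewrite exprn_gt0.
have Xd := linear_setB Xlin (Xs N) Xl.
have n1 : semi_norm ipg (s N - l) <= e1.
  rewrite -(@ler_pXn2r _ 2) ?nnegrE ?semi_norm_ge0 ?(ltW e10)//.
  by rewrite (sqr_semi_norm ip_grad_semi_inner Xd) ltW// HN.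
have de : ae_eq mu Om (div Om (s N - l)) (- div Om l).
  have := div_lin (-1) Xl (Xs N); rewrite scaleN1r addrC.
  have [_] := Vs N; apply: filterS2 => x h1 h2 Dx.
  rewrite h2// (_ : (_ + _) x = -1 * div Om l x + div Om (s N) x)//.
  by rewrite h1// addr0 mulN1r.
have hN : L2 (- div Om l) by rewrite -scaleN1r; exact: linear_setZ.
have hd := div_L2 Xd.
have -> : semi_norm a (div Om l) = semi_norm a (div Om (s N - l)).
  rewrite -(semi_normN L2lin asi hl) /semi_norm; congr (Num.sqrt _).
  rewrite -(ipL2_ae oOm hd hN hN de) (semi_inner_sym asi)//.
  by rewrite -(ipL2_ae oOm hd hN hd de).
apply: le_trans (div_norm Xd) _.
apply: (@le_trans _ _ (d.+1%:R * e1)); last by rewrite /e1 mulrC divfK.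
by apply: ler_pM => //; [exact: semi_norm_ge0|rewrite ler_nat].
Qed.

End complete.
End fields.

(** * Bounds and skew-symmetry of the convective form *)

Section bform.
Context {R : realType} {d : nat} (Om : set 'rV[R]_d).
Hypothesis oOm : open Om.
Local Notation mu := (lebesgue_row R d).
Local Notation test := (test_fun Om).
Local Notation L2 := (sq_integrable mu Om).
Local Notation a := (ipL2 mu Om).
Local Notation X := (spaceX Om : set ('rV[R]_d -> 'rV[R]_d)).
Local Notation V := (spaceV Om : set ('rV[R]_d -> 'rV[R]_d)).
Local Notation ipg := (ip_grad Om).
Local Notation N := (norm_grad Om).

Let mOm : measurable Om. Proof. exact: open_row_measurable. Qed.
Let L2lin : linear_set L2. Proof. exact: sq_integrable_linear. Qed.
Let asi : semi_inner L2 a. Proof. exact: ipL2_semi_inner. Qed.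
Let Xlin := spaceX_linear oOm.
Let gsi := ip_grad_semi_inner oOm.

Context (M : R) (hM : trilinear_bounds Om M).

Lemma conv_rinteg u v w : X u -> X v -> X w -> rinteg mu Om (conv_density Om u v w).
Proof. by move=> Xu Xv Xw; have [] := hM Xu Xv Xw. Qed.

Lemma Rintegral_lin (k : R) (f g h : 'rV[R]_d -> R) :
  rinteg mu Om f -> rinteg mu Om g -> rinteg mu Om h ->
  ae_eq mu Om h (fun x => k * f x + g x) ->
  \int[mu]_(x in Om) h x = k * (\int[mu]_(x in Om) f x) + \int[mu]_(x in Om) g x.
Proof.
move=> hf hg hh e; have hkf := rintegZ mOm k hf.
rewrite -(RintegralZl _ mOm hf) -(RintegralD mOm hkf hg).
apply: Rintegral_ae => //; first exact: rinteg_measurable hh.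
exact: rinteg_measurable (rintegD mOm hkf hg).
Qed.

Lemma bform_lin1 v w : X v -> X w -> linear_on X (fun u => bform Om u v w).
Proof.
move=> Xv Xw k u u' Xu Xu'; have Xk := Xlin.2 k _ _ Xu Xu'.
apply: Rintegral_lin; [exact: conv_rinteg..|].
apply/aeW => x _; rewrite /conv_density mulr_sumr -big_split; apply: eq_bigr => j _ /=.
rewrite mulrA -mulrDl; congr (_ * _); rewrite mulr_sumr -big_split.
by apply: eq_bigr => i _ /=; rewrite !mxE mulrDl mulrA.
Qed.

Lemma bform_lin2 u w : X u -> X w -> linear_on X (fun v => bform Om u v w).
Proof.
move=> Xu Xw k v v' Xv Xv'; have Xk := Xlin.2 k _ _ Xv Xv'.
apply: Rintegral_lin; [exact: conv_rinteg..|].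
have : {ae mu, forall x, forall ij, Om x -> partial Om (k *: v + v') ij.1 ij.2 x =
    (k *: partial Om v ij.1 ij.2 + partial Om v' ij.1 ij.2) x}.
  by apply: filter_forall => -[i j]; exact: partial_lin.
apply: filterS => x h Dx.
rewrite /conv_density mulr_sumr -big_split; apply: eq_bigr => j _ /=.
rewrite mulrA -mulrDl; congr (_ * _); rewrite mulr_sumr -big_split.
apply: eq_bigr => i _ /=; rewrite (h (i, j) Dx).
rewrite (_ : (_ + _) x = k * partial Om v i j x + partial Om v' i j x)//.
by rewrite mulrDr mulrCA.
Qed.

Lemma bform_lin3 u v : X u -> X v -> linear_on X (bform Om u v).
Proof.
move=> Xu Xv k w w' Xw Xw'; have Xk := Xlin.2 k _ _ Xw Xw'.
apply: Rintegral_lin; [exact: conv_rinteg..|].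
apply/aeW => x _; rewrite /conv_density mulr_sumr -big_split; apply: eq_bigr => j _ /=.
by rewrite !mxE mulrDr mulrCA.
Qed.

Lemma bformN u v w : X u -> X v -> X w -> bform Om u v (- w) = - bform Om u v w.
Proof. by move=> Xu Xv Xw; exact: (linear_onN Xlin (bform_lin3 Xu Xv)). Qed.

Lemma norm_gradN v : X v -> N (- v) = N v.
Proof. exact: (semi_normN Xlin gsi). Qed.

Lemma norm_grad_ge0 v : 0 <= N v.
Proof. exact: sqrtr_ge0. Qed.

(** The trilinear bounds are one-sided, so the bound is applied to [w] and to [- w]; the premise is
    stated for all [z] with the gradient norm of [w] to cover both. No sign of [M] is assumed, hence
    the absolute value. *)
Lemma bform_norm_le (C : R) u v w : X u -> X v -> X w ->
  (forall z, X z -> N z = N w -> bform Om u v z <= M * C) -> 0 <= C ->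
  `|bform Om u v w| <= `|M| * C.
Proof.
move=> Xu Xv Xw h C0; have XNw : X (- w) by rewrite -scaleN1r; exact: (linear_setZ Xlin).
have le1 : M * C <= `|M| * C by rewrite ler_wpM2r// ler_norm.
rewrite ler_norml lerNl; apply/andP; split; apply: le_trans le1.
  by rewrite -(bformN Xu Xv Xw); exact: (h _ XNw (norm_gradN Xw)).
exact: (h _ Xw erefl).
Qed.

Lemma bform_bound u v w : X u -> X v -> X w ->
  `|bform Om u v w| <= `|M| * N u * N v * N w.
Proof.
move=> Xu Xv Xw; have h z : X z -> N z = N w -> bform Om u v z <= M * (N u * N v * N w).
  by move=> Xz <-; have [_ _ + _] := hM Xu Xv Xz; rewrite !mulrA.
have C0 : 0 <= N u * N v * N w by rewrite !mulr_ge0 ?norm_grad_ge0.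
by have := bform_norm_le Xu Xv Xw h C0; rewrite !mulrA.
Qed.

Lemma bform_interpolation_bound u v w : X u -> X v -> X w ->
  `|bform Om u v w| <= `|M| * Num.sqrt (L2norm Om u * N u) * N v * N w.
Proof.
move=> Xu Xv Xw; pose r := Num.sqrt (L2norm Om u * N u).
have h z : X z -> N z = N w -> bform Om u v z <= M * (r * N v * N w).
  move=> Xz <-; have [_ + _ _] := hM Xu Xv Xz.
  by rewrite /r sqrtrM ?sqrtr_ge0// !mulrA.
have C0 : 0 <= r * N v * N w by rewrite !mulr_ge0 ?norm_grad_ge0// sqrtr_ge0.
by have := bform_norm_le Xu Xv Xw h C0; rewrite !mulrA.
Qed.

(** The field carries no divergence constraint, so its components can be approximated independently;
    only the transporting field has to be divergence free. *)
Definition test_field (v : 'rV[R]_d -> 'rV[R]_d) := forall j, test (coord v j).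

Lemma test_field_spaceX v : test_field v -> X v.
Proof. by move=> tv j; eexists; exact: (H10_gradient_test oOm (tv j)). Qed.

Lemma partial_test_field v i j : test_field v ->
  ae_eq mu Om (partial Om v i j) ('D_'e_i (coord v j)).
Proof.
move=> tv; have := grad_ae oOm i (H10_gradient_test oOm (tv j)).
by apply: filterS => x h /h; rewrite /coord mxE.
Qed.

Lemma test_field_dense w (e : R) : X w -> 0 < e ->
  exists2 v, test_field v & N (w - v) <= e.
Proof.
move=> Xw e0; pose e1 := e ^+ 2 / d.+1%:R.
have e10 : 0 < e1 by rewrite divr_gt0// exprn_gt0.
have ex j : exists phi, test phi /\
    \sum_(i < d) a (coord (grad Om (coord w j)) i - 'D_'e_i phi)
                   (coord (grad Om (coord w j)) i - 'D_'e_i phi) < e1.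
  have /H10_gradientP[hw hg _ he] := spaceX_gradient j Xw.
  have [phi tphi phie] := he _ e10; exists phi; split => //.
  apply: le_lt_trans phie; rewrite lerDr; apply: (semi_inner_ge0 asi).
  by apply: (linear_setB L2lin) => //; exact: L2_test.
have [phi Hphi] := choice ex; pose v : 'rV[R]_d -> 'rV[R]_d := fun x => \row_j phi j x.
have vE j : coord v j = phi j by apply/funext => x; rewrite /coord mxE.
have tv : test_field v by move=> j; rewrite vE; exact: (Hphi j).1.
have Xv := test_field_spaceX tv; have Xwv := linear_setB Xlin Xw Xv.
exists v => //; rewrite -(@ler_pXn2r _ 2) ?nnegrE ?norm_grad_ge0 ?(ltW e0)//.
rewrite (sqr_semi_norm gsi Xwv) (ip_gradE oOm Xwv Xwv) exchange_big /=.
apply: (@le_trans _ _ (\sum_(j < d) e1)); last first.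
  rewrite sumr_const card_ord -mulr_natl /e1 mulrCA ler_piMr ?sqr_ge0//.
  by rewrite ler_pdivrMr// mul1r ler_nat.
apply: ler_sum => j _; apply: le_trans (ltW (Hphi j).2).
rewrite le_eqVlt; apply/orP; left; apply/eqP; apply: eq_bigr => i _.
have h1 := partial_L2 i j Xwv.
have h2 := linear_setB L2lin (partial_L2 i j Xw) (L2_partial_test oOm i (Hphi j).1).
have e12 : ae_eq mu Om (partial Om (w - v) i j) (partial Om w i j - 'D_'e_i (phi j)).
  have := partial_lin oOm (-1) i j Xv Xw; rewrite scaleN1r addrC.
  have := partial_test_field i j tv; rewrite vE; apply: filterS2 => x f1 f2 Dx.
  rewrite f2// (_ : (_ + _) x = -1 * partial Om v i j x + partial Om w i j x)//.
  by rewrite f1// mulN1r addrC.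
rewrite (ipL2_ae oOm h1 h2 h1 e12) (semi_inner_sym asi h2 h1).
by rewrite (ipL2_ae oOm h1 h2 h2 e12).
Qed.

(* (u . grad v) . v is half of u . grad |v|^2, and |v|^2 is a test function. *)
Lemma bform_test_field u v : V u -> test_field v -> bform Om u v v = 0.
Proof.
move=> [Xu du] tv; have Xv := test_field_spaceX tv.
have [lin _ _] := asi.
have Lu i : L2 (coord u i) by exact: (spaceX_L2 Xu i).
have tD i j : test ('D_'e_i (coord v j)) by exact: test_fun_partial.
have LDv i j : L2 ('D_'e_i (coord v j) * coord v j).
  by apply: L2_test => //; exact: test_funM.
have r i j : rinteg mu Om (fun x => coord u i x * ('D_'e_i (coord v j) * coord v j) x).
  exact: sq_integrableM.
transitivity (\sum_(j < d) \sum_(i < d) a (coord u i) ('D_'e_i (coord v j) * coord v j)).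
  transitivity (\int[mu]_(x in Om) (\sum_(j < d) \sum_(i < d)
     coord u i x * ('D_'e_i (coord v j) * coord v j) x)); last first.
    rewrite Rintegral_sum//; last by move=> j; exact: rinteg_sum.
    by apply: eq_bigr => j _; rewrite Rintegral_sum.
  apply: Rintegral_ae => //; first exact: rinteg_measurable (conv_rinteg Xu Xv Xv).
    by apply: rinteg_measurable; apply: rinteg_sum => // j; exact: rinteg_sum.
  have : {ae mu, forall x, forall ij, Om x -> partial Om v ij.1 ij.2 x =
      'D_'e_ij.1 (coord v ij.2) x}.
    by apply: filter_forall => -[i j]; exact: partial_test_field.
  apply: filterS => x h Dx; apply: eq_bigr => j _; rewrite mulr_suml.
  by apply: eq_bigr => i _; rewrite (h (i, j) Dx) -mulrA.
apply: big1 => j _; have tvv := test_funM (tv j) (tv j).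
(* The square of [coord v j] is inserted into the weak gradient of [coord u i]. Summing over [i]
   then produces [div Om u], which vanishes almost everywhere. *)
have key i : a (coord u i) ('D_'e_i (coord v j) * coord v j) =
    - 2^-1 * a (partial Om u i i) (coord v j * coord v j).
  have [_ _ wg _] := spaceX_gradient i Xu.
  have := (weak_gradient_ip Om (coord u i) _).1 wg i _ tvv.
  have -> : 'D_'e_i (coord v j * coord v j) = 2 *: ('D_'e_i (coord v j) * coord v j).
    apply/funext => x; have dv : derivable (coord v j) x 'e_i by exact: (test_fun_derivable (tv j)).
    have -> := deriveM dv dv.
    rewrite (_ : (2 *: _) x = 2 * ('D_'e_i (coord v j) x * coord v j x))//.
    by rewrite -[_ *: _]/(coord v j x * _); ring.
  rewrite (semi_innerZr L2lin asi)// => /(congr1 (fun z => 2^-1 * z)).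
  by rewrite mulKf// => ->; rewrite mulrN mulNr.
under eq_bigr do rewrite key.
rewrite -mulr_sumr; have Lvv := L2_test oOm tvv.
suff -> : \sum_(i < d) a (partial Om u i i) (coord v j * coord v j) = 0 by rewrite mulr0.
transitivity (a (div Om u) (coord v j * coord v j)).
  rewrite /ipL2 -Rintegral_sum//; last first.
    by move=> i; apply: sq_integrableM => //; exact: partial_L2.
  by apply: eq_Rintegral => x _; rewrite -mulr_suml.
rewrite (ipL2_ae oOm (div_L2 oOm Xu) (linear_set0 L2lin) Lvv du).
exact: (linear_on0 L2lin (lin _ Lvv)).
Qed.

(** For a test field [v] close to [w], the identity [bform Om u v v = 0] leaves [bform Om u (w - v)
    w + bform Om u v (w - v)], and both terms are small by continuity. *)
Lemma bform_skew u w : V u -> X w -> bform Om u w w = 0.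
Proof.
(* [C * t] bounds the two terms together when [N (w - v) <= t <= 1]: then [N w + N v] is at most
   [2 * N w + 1]. *)
move=> Vu Xw; have Xu : X u by case: Vu.
pose C := `|M| * N u * (2 * N w + 1).
have C0 : 0 <= C.
  by rewrite !mulr_ge0 ?norm_grad_ge0// addr_ge0// mulr_ge0// norm_grad_ge0.
apply/eqP; rewrite -normr_le0; apply/ler_addgt0Pl => e e0; rewrite addr0.
pose t := Num.min 1 (e / (C + 1)).
have C1 : 0 < C + 1 by rewrite ltr_wpDl.
have t0 : 0 < t by rewrite /t lt_min ltr01 divr_gt0.
have t1 : t <= 1 by rewrite /t ge_min lexx.
have Ct : C * t <= e.
  have : t <= e / (C + 1) by rewrite /t ge_min lexx orbT.
  by rewrite ler_pdivlMr//; nra.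
have [v tv wv] := test_field_dense Xw t0.
have Xv := test_field_spaceX tv; have Xwv := linear_setB Xlin Xw Xv.
have -> : bform Om u w w = bform Om u (w - v) w + bform Om u v (w - v).
  have := linear_onB Xlin (bform_lin2 Xu Xw) Xw Xv.
  have := linear_onB Xlin (bform_lin3 Xu Xv) Xw Xv.
  have := bform_test_field Vu tv.
  by move: (bform Om u) => B -> -> ->; rewrite subr0 subrK.
have Nv : N v <= N w + t.
  have -> : v = w - (w - v) by rewrite opprB addrC subrK.
  have XN : X (- (w - v)) by rewrite -scaleN1r; exact: (linear_setZ Xlin).
  apply: le_trans (semi_normD Xlin gsi Xw XN) _.
  by rewrite lerD2l; rewrite -[semi_norm _ _]/(N _) norm_gradN.
apply: le_trans (ler_normD _ _) _; apply: le_trans Ct.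
have b1 := bform_bound Xu Xwv Xw; have b2 := bform_bound Xu Xv Xwv.
have MN : 0 <= `|M| * N u by rewrite mulr_ge0 ?norm_grad_ge0.
apply: (le_trans (lerD b1 b2)).
have Nw0 := norm_grad_ge0 w; have Nv0 := norm_grad_ge0 v; have Nwv0 := norm_grad_ge0 (w - v).
move: MN Nw0 Nv0 Nwv0 wv Nv; rewrite /C; clear -t1.
move: (`|M| * N u) (N w) (N v) (N (w - v)) => c x y z c0 x0 y0 z0 zt yx.
rewrite -!mulrA -mulrDr ler_wpM2l//.
have h1 : z * x <= t * x by rewrite ler_wpM2r.
have h2 : y * z <= (x + 1) * t by apply: ler_pM => //; apply: le_trans yx _; rewrite lerD2l.
by move: h1 h2; lra.
Qed.

End bform.

(** * The energy of the assimilation system *)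

Section dual.
Context {R : realType} {d : nat} (Om : set 'rV[R]_d).
Context (f : ('rV[R]_d -> 'rV[R]_d) -> R) (hf : dualX Om f).
Local Notation N := (norm_grad Om).

Let S := [set `|f v| / N v | v in [set v | spaceX Om v /\ N v != 0]].

Lemma dual_norm_has_ubound : has_ubound S.
Proof.
have [_ [C HC]] := hf; exists C => _ [w [Xw w0] <-].
have wp : 0 < N w by rewrite lt_neqAle eq_sym w0 norm_grad_ge0.
by rewrite ler_pdivrMr//; exact: HC.
Qed.

Lemma dual_norm_ge0 : 0 <= dual_norm Om f.
Proof.
have [[y Sy]|nS] := pselect (S !=set0); last first.
  (* If every field has zero gradient norm, the set of quotients is empty and its supremum is 0 by
     convention. *)
  rewrite /dual_norm (_ : [set _ | _ in _] = set0) ?sup0//.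
  by apply/seteqP; split => // y Sy; apply: nS; exists y.
have : y <= dual_norm Om f by apply: ub_le_sup Sy; exact: dual_norm_has_ubound.
apply: le_trans; case: Sy => v _ <-.
by rewrite divr_ge0 ?norm_grad_ge0.
Qed.

Lemma dual_norm_bound v : spaceX Om v -> `|f v| <= dual_norm Om f * N v.
Proof.
move=> Xv; have [_ [C HC]] := hf.
have [v0|v0] := eqVneq (N v) 0; first by have := HC _ Xv; rewrite v0 !mulr0.
have vp : 0 < N v by rewrite lt_neqAle eq_sym v0 norm_grad_ge0.
rewrite -ler_pdivrMr//; apply: ub_le_sup; last by exists v.
exact: dual_norm_has_ubound.
Qed.

End dual.

(** Young's inequality with the weights of the coercivity bound: for [s] equal to [CI * H], the
    bracket is the left-hand side of that bound with the minimum resolved. *)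
Lemma amgm_weighted (R : realFieldType) (nu s x y : R) : 0 < nu -> 0 < s ->
  x * y <= s / nu * (nu / 2 * y ^+ 2 + nu / (2 * s ^+ 2) * x ^+ 2).
Proof.
move=> nu0 s0; rewrite -subr_ge0.
have -> : s / nu * (nu / 2 * y ^+ 2 + nu / (2 * s ^+ 2) * x ^+ 2) - x * y =
    (x - s * y) ^+ 2 / (2 * s) by field; rewrite !gt_eqF.
by rewrite divr_ge0 ?sqr_ge0// mulr_ge0// ltW.
Qed.

(** The arithmetic behind the formula for [Cv]. Here [p], [q] and [r] are the norms of the gradient
    of the solution, of its interpolant and of the interpolant of [u], while [y] and [x] are the two
    load terms. Young's inequality absorbs half of [nuh * p ^+ 2] and half of [mu * q ^+ 2] on the
    left. *)
Lemma energy_estimate (R : realFieldType) (nu nuh mu CI CP D p q r x y : R) :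
  0 < nu -> 0 < nuh -> 0 < mu ->
  nuh * p ^+ 2 + mu * q ^+ 2 = y + mu * x -> y <= D * p -> x <= r * q ->
  r ^+ 2 <= CI ^+ 2 * CP ^+ 2 * (nu ^- 2 * D ^+ 2) ->
  p ^+ 2 <= (nuh ^- 2 + mu * CP ^+ 2 * CI ^+ 2 * nu ^- 2 * nuh^-1) * D ^+ 2.
Proof.
move=> hnu hnuh hmu e h1 h2 r2.
have e1 : nuh * p ^+ 2 + mu * q ^+ 2 <= D * p + mu * (r * q).
  by rewrite e lerD// ler_wpM2l// ltW.
have m0 : 0 <= mu * (r - q) ^+ 2 by rewrite mulr_ge0 ?sqr_ge0// ltW.
have m1 : 2 * (D * p) <= nuh * p ^+ 2 + D ^+ 2 / nuh.
  rewrite -subr_ge0.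
  have -> : nuh * p ^+ 2 + D ^+ 2 / nuh - 2 * (D * p) = (nuh * p - D) ^+ 2 / nuh.
    by field; rewrite gt_eqF.
  by rewrite divr_ge0 ?sqr_ge0// ltW.
have m2 : 0 <= mu * q ^+ 2 by rewrite mulr_ge0 ?sqr_ge0// ltW.
have e2 : nuh * p ^+ 2 <= D ^+ 2 / nuh + mu * r ^+ 2.
  by move: e1 m0 m1 m2; rewrite sqrrB; move: (D ^+ 2 / nuh) => z; nra.
rewrite -(ler_pM2l hnuh); apply: le_trans e2 _.
have -> : nuh * ((nuh ^- 2 + mu * CP ^+ 2 * CI ^+ 2 * nu ^- 2 / nuh) * D ^+ 2) =
  D ^+ 2 / nuh + mu * (CI ^+ 2 * CP ^+ 2 * (nu ^- 2 * D ^+ 2)).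
  by field; rewrite !gt_eqF.
by rewrite lerD2l ler_wpM2l// ltW.
Qed.

Lemma prod4_le (R : realFieldType) (m x1 x2 x3 y1 y2 y3 : R) :
  0 <= m -> 0 <= x1 -> 0 <= x2 -> 0 <= x3 -> x1 <= y1 -> x2 <= y2 -> x3 <= y3 ->
  m * x1 * x2 * x3 <= m * y1 * y2 * y3.
Proof.
move=> m0 x10 x20 x30 h1 h2 h3.
by do 2!(apply: ler_pM; rewrite ?mulr_ge0//); rewrite ler_wpM2l.
Qed.

Lemma prod3_le (R : realFieldType) (m c x1 x2 x3 y1 y2 y3 : R) : 0 <= m -> 0 <= c ->
  0 <= y3 -> 0 <= y2 -> 0 <= y1 -> 0 <= x3 -> 0 <= x2 -> 0 <= x1 ->
  x3 <= c * y3 -> x2 <= c * y2 -> x1 <= c * y1 ->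
  m * x1 * x2 * x3 <= m * c ^+ 3 * y1 * y2 * y3.
Proof.
move=> m0 c0 y30 y20 y10 x30 x20 x10 h3 h2 h1.
have -> : m * c ^+ 3 * y1 * y2 * y3 = m * (c * y1) * (c * y2) * (c * y3) by ring.
exact: prod4_le.
Qed.

Section energy.
Context {R : realType} {d : nat} (Om : set 'rV[R]_d) (M CP CI H nu nuh mu : R).
Context (f : ('rV[R]_d -> 'rV[R]_d) -> R).
Context (I : ('rV[R]_d -> 'rV[R]_d) -> 'rV[R]_d -> 'rV[R]_d).
Context (u : 'rV[R]_d -> 'rV[R]_d).
Hypotheses (oOm : open Om) (hM : trilinear_bounds Om M) (hCP : poincare_constant Om CP)
  (hf : dualX Om f) (hnu : 0 < nu) (hnuh : 0 < nuh) (hmu : 0 < mu) (hH : 0 < H)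
  (hCI : 0 < CI) (hI : interpolation_operator Om I H CI)
  (hIcoer : interpolation_coercivity Om I H CI nuh mu)
  (hu : NSE_weak_solution Om nu f u)
  (hHsmall : H * (Num.sqrt 27 * CI * M ^+ 2 * Cv Om nu nuh mu CP CI f ^+ 2)
             <= Num.sqrt 2 * nuh ^+ 2)
  (hmularge : nuh / (2 * CI ^+ 2 * H ^+ 2) <= mu).

Local Notation lam := (lebesgue_row R d).
Local Notation X := (spaceX Om : set ('rV[R]_d -> 'rV[R]_d)).
Local Notation V := (spaceV Om : set ('rV[R]_d -> 'rV[R]_d)).
Local Notation LF := (L2_field Om : set ('rV[R]_d -> 'rV[R]_d)).
Local Notation ipg := (ip_grad Om).
Local Notation N := (norm_grad Om).
Local Notation L := (L2norm Om).
Local Notation D := (dual_norm Om f).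
Local Notation C := (Cv Om nu nuh mu CP CI f).

Let Xlin : linear_set X := spaceX_linear oOm.
Let Vlin : linear_set V := spaceV_linear oOm.
Let gsi : semi_inner X ipg := ip_grad_semi_inner oOm.
Let isi : semi_inner LF (ip Om) := ip_semi_inner oOm.
Let Llin : linear_set LF := L2_field_linear oOm.

Lemma spaceV_X v : V v -> X v. Proof. by case. Qed.

Lemma interp_L2 v : X v -> LF (I v). Proof. by case: hI => + _ _ _; apply. Qed.

Lemma sqr_norm_grad v : X v -> N v ^+ 2 = ipg v v.
Proof. exact: (sqr_semi_norm gsi). Qed.

Lemma sqr_L2norm v : LF v -> L v ^+ 2 = ip Om v v.
Proof. exact: (sqr_semi_norm isi). Qed.

Lemma L2norm_ge0 v : 0 <= L v. Proof. exact: sqrtr_ge0. Qed.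

Lemma ip_interp_lin z : X z -> linear_on X (fun v => ip Om (I v) (I z)).
Proof.
move=> Xz k v w Xv Xw; have Xkv := Xlin.2 k _ _ Xv Xw.
have [lin _ _] := isi; rewrite -(lin _ (interp_L2 Xz) k _ _ (interp_L2 Xv) (interp_L2 Xw)).
have h1 := interp_L2 Xkv; have h3 := interp_L2 Xz.
have h2 := Llin.2 k _ _ (interp_L2 Xv) (interp_L2 Xw).
have [_ ae _ _] := hI; have := ae k _ _ Xv Xw => e.
rewrite (ipE oOm h1 h3) (ipE oOm h2 h3); apply: eq_bigr => j _.
apply: (ipL2_ae oOm (h1 j) (h2 j) (h3 j)); apply: filterS e => x h Dx.
by rewrite /coord h.
Qed.

Definition energy v w := nuh * ipg v w + mu * ip Om (I v) (I w).

Lemma energy_semi_inner : semi_inner V energy.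
Proof.
have [lin sym ge0] := gsi.
split=> [z Vz k v w Vv Vw|v w Vv Vw|v Vv]; rewrite /energy.
- have [Xz Xv Xw] := And3 (spaceV_X Vz) (spaceV_X Vv) (spaceV_X Vw).
  have := lin _ Xz k _ _ Xv Xw; have := ip_interp_lin Xz k Xv Xw.
  by move: (ip Om) ipg => b1 b2 -> ->; ring.
- have [Xv Xw] := conj (spaceV_X Vv) (spaceV_X Vw).
  by rewrite (sym v w Xv Xw) (semi_inner_sym isi (interp_L2 Xv) (interp_L2 Xw)).
- have Xv := spaceV_X Vv; rewrite addr_ge0 ?mulr_ge0 ?(ltW hmu) ?(ltW hnuh) ?ge0//.
  by apply: (semi_inner_ge0 isi); exact: interp_L2.
Qed.

Local Notation E := (semi_norm energy).

Lemma sqr_energy v : V v -> E v ^+ 2 = nuh * N v ^+ 2 + mu * L (I v) ^+ 2.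
Proof.
move=> Vv; have Xv := spaceV_X Vv.
by rewrite (sqr_semi_norm energy_semi_inner Vv) (sqr_norm_grad Xv) (sqr_L2norm (interp_L2 Xv)).
Qed.

Lemma norm_grad_energy v : V v -> N v <= Num.sqrt nuh^-1 * E v.
Proof.
move=> Vv; rewrite -(@ler_pXn2r _ 2) ?nnegrE ?mulr_ge0 ?sqrtr_ge0//.
have i0 : 0 <= nuh^-1 by rewrite invr_ge0 ltW.
rewrite exprMn (sqr_sqrtr i0) (sqr_energy Vv) mulrDr mulKf ?gt_eqF//.
by rewrite lerDl (mulr_ge0 i0)// mulr_ge0 ?sqr_ge0// ltW.
Qed.

Lemma L2norm_interp v : X v -> L (I v) <= CI * (CP * N v).
Proof.
move=> Xv; have [_ _ + _] := hI => /(_ v Xv) /le_trans; apply.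
by rewrite ler_wpM2l ?(ltW hCI)//; exact: hCP.
Qed.

Lemma sqr_L2norm_interp v : X v -> L (I v) ^+ 2 <= CI ^+ 2 * CP ^+ 2 * N v ^+ 2.
Proof.
move=> Xv; have h := L2norm_interp Xv.
have h0 : 0 <= CI * (CP * N v) by apply: le_trans h; exact: L2norm_ge0.
by rewrite -!exprMn -mulrA ler_pXn2r ?nnegrE// L2norm_ge0.
Qed.

(** The energy is equivalent to the gradient form: it is at least [nuh] times it, and at most [K]
    times it by L^2 boundedness of [I] and the Poincaré inequality. *)
Lemma energy_complete : complete_for V energy.
Proof.
move=> s Vs sC; have gc := spaceV_complete oOm hCP.
pose K := nuh + mu * (CI ^+ 2 * CP ^+ 2).
have K0 : 0 < K by rewrite ltr_pwDl// mulr_ge0 ?(ltW hmu)// mulr_ge0 ?sqr_ge0.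
have up v : V v -> energy v v <= K * ipg v v.
  move=> Vv; have Xv := spaceV_X Vv.
  rewrite -(sqr_semi_norm energy_semi_inner Vv) (sqr_energy Vv) -(sqr_norm_grad Xv).
  by rewrite /K mulrDl lerD2l -mulrA ler_wpM2l ?(ltW hmu)// sqr_L2norm_interp.
have low v : V v -> nuh * ipg v v <= energy v v.
  move=> Vv; have Xv := spaceV_X Vv.
  rewrite -(sqr_semi_norm energy_semi_inner Vv) (sqr_energy Vv) -(sqr_norm_grad Xv).
  by rewrite lerDl mulr_ge0 ?sqr_ge0// ltW.
have [e e0|l Vl sl] := gc s Vs.
  have [|n Hn] := sC (nuh * e); first by rewrite mulr_gt0.
  exists n => m k nm nk; have Vd := linear_setB Vlin (Vs m) (Vs k).
  by have := le_lt_trans (low _ Vd) (Hn _ _ nm nk); rewrite ltr_pM2l.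
exists l => // e e0; have [|n Hn] := sl (e / K); first by rewrite divr_gt0.
exists n => m nm; have Vd := linear_setB Vlin (Vs m) Vl.
apply: le_lt_trans (up _ Vd) _; have := Hn _ nm.
by rewrite ltr_pdivlMr// mulrC.
Qed.

(** The forcing together with the observations of [u], the part of the nudging term that is
    independent of the unknown. *)
Definition load chi := f chi + mu * ip Om (I u) (I chi).

Lemma sol_X : X u. Proof. by case: hu => /spaceV_X. Qed.

Lemma load_lin : linear_on V load.
Proof.
move=> k v w /spaceV_X Xv /spaceV_X Xw; have Xkv := Xlin.2 k _ _ Xv Xw.
have [fl _] := hf; have Xu := sol_X.
have := ip_interp_lin Xu k Xv Xw.
have Iu := interp_L2 Xu.
have := semi_inner_sym isi Iu (interp_L2 Xkv).
have := semi_inner_sym isi Iu (interp_L2 Xv).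
have := semi_inner_sym isi Iu (interp_L2 Xw).
rewrite /load (fl k v w Xv Xw : f (k *: v + w) = _).
by move: (ip Om) => b -> -> -> /= ->; ring.
Qed.

Lemma load_bound : exists K, forall v, V v -> `|load v| <= K * E v.
Proof.
have Xu := sol_X.
exists ((D + mu * (L (I u) * (CI * `|CP|))) * Num.sqrt nuh^-1) => v Vv; have Xv := spaceV_X Vv.
have D0 := dual_norm_ge0 hf.
have Nv0 := norm_grad_ge0 Om v; have Lu0 := L2norm_ge0 (I u).
have K0 : 0 <= D + mu * (L (I u) * (CI * `|CP|)).
  by rewrite addr_ge0// !mulr_ge0// ltW.
rewrite -mulrA; apply: le_trans (ler_wpM2l K0 (norm_grad_energy Vv)).
rewrite /load; apply: le_trans (ler_normD _ _) _; rewrite mulrDl.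
apply: lerD; first exact: dual_norm_bound.
rewrite normrM gtr0_norm// -!mulrA ler_wpM2l ?(ltW hmu)//.
apply: le_trans (cauchy_schwarz_norm Llin isi (interp_L2 Xu) (interp_L2 Xv)) _.
apply: (ler_wpM2l Lu0); apply: le_trans (L2norm_interp Xv) _.
apply: ler_wpM2l; first exact: ltW.
by apply: (ler_wpM2r Nv0); exact: ler_norm.
Qed.

Lemma CDA_solutionP v : CDA_solution Om nuh mu I f u v <->
  V v /\ forall chi, V chi -> energy v chi + bform Om v v chi = load chi.
Proof.
have Xu := sol_X.
have key : V v -> forall chi, V chi -> ip Om (I (fun x => v x - u x)) (I chi) =
    ip Om (I v) (I chi) - ip Om (I u) (I chi).
  move=> /spaceV_X Xv chi /spaceV_X Xchi.
  exact: (linear_onB Xlin (ip_interp_lin Xchi) Xv Xu).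
split=> -[Vv h]; split=> // chi Vchi; have := h _ Vchi; rewrite key// /energy /load.
  by move: (ip Om) (ipg v chi) (bform Om v v chi) => b x y <-; ring.
move: (ip Om) (ipg v chi) (bform Om v v chi) => b x y e.
have : nuh * x + y + mu * (b (I v) (I chi) - b (I u) (I chi)) =
   (nuh * x + mu * b (I v) (I chi) + y) - mu * b (I u) (I chi) by ring.
by move=> ->; rewrite e addrK.
Qed.

Lemma sol_bound : N u <= nu^-1 * D.
Proof.
have [Vu eu] := hu; have Xu := sol_X; have := eu _ Vu.
rewrite (bform_skew oOm hM Vu Xu) addr0 -(sqr_norm_grad Xu) => e.
have h := le_trans (ler_norm _) (dual_norm_bound hf Xu).
have [->|n0] := eqVneq (N u) 0.
  by rewrite mulr_ge0 ?invr_ge0 ?(ltW hnu)//; exact: (dual_norm_ge0 hf).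
have np : 0 < N u by rewrite lt_neqAle eq_sym n0 norm_grad_ge0.
rewrite mulrC ler_pdivlMr// -(ler_pM2r np).
have -> : N u * nu * N u = nu * N u ^+ 2 by ring.
by rewrite e.
Qed.

Lemma Cv_ge0 : 0 <= C.
Proof. by rewrite /Cv mulr_ge0 ?sqrtr_ge0//; exact: (dual_norm_ge0 hf). Qed.

Lemma sqr_Cv : C ^+ 2 =
  (nuh ^- 2 + mu * CP ^+ 2 * CI ^+ 2 * nu ^- 2 * nuh^-1) * D ^+ 2.
Proof.
rewrite /Cv exprMn sqr_sqrtr// addr_ge0 ?invr_ge0 ?exprn_ge0 ?(ltW hnuh)//.
have i0 (x : R) : 0 < x -> 0 <= x^-1 by move=> x0; rewrite invr_ge0 ltW.
do 4!(apply: mulr_ge0; rewrite ?sqr_ge0 ?(ltW hmu) ?i0 ?exprn_gt0//).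
Qed.

(** Skewness removes the convective term whatever the transporting field [v0] is, so one bound
    covers the values of the Picard map and, with [v0 = v], the solutions of the nonlinear
    system. *)
Lemma a_priori v0 v : V v0 -> V v ->
  (forall chi, V chi -> energy v chi + bform Om v0 v chi = load chi) -> N v <= C.
Proof.
move=> Vv0 Vv eqn; have Xv := spaceV_X Vv; have Xu := sol_X.
have := eqn _ Vv; rewrite (bform_skew oOm hM Vv0 Xv) addr0.
rewrite -(sqr_semi_norm energy_semi_inner Vv) (sqr_energy Vv) /load => e.
have h1 := le_trans (ler_norm _) (dual_norm_bound hf Xv).
have h2 := le_trans (ler_norm _)
  (cauchy_schwarz_norm Llin isi (interp_L2 Xu) (interp_L2 Xv)).
have h2' : ip Om (I u) (I v) <= L (I u) * L (I v) by exact: h2.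
have h3 := sqr_L2norm_interp Xu.
have h4 : N u ^+ 2 <= nu ^- 2 * D ^+ 2.
  rewrite -exprVn -exprMn ler_pXn2r ?nnegrE ?norm_grad_ge0//; first exact: sol_bound.
  by rewrite mulr_ge0 ?invr_ge0 ?(ltW hnu)//; exact: (dual_norm_ge0 hf).
rewrite -(@ler_pXn2r _ 2) ?nnegrE ?norm_grad_ge0 ?Cv_ge0// sqr_Cv.
have r2 : L (I u) ^+ 2 <= CI ^+ 2 * CP ^+ 2 * (nu ^- 2 * D ^+ 2).
  by apply: le_trans h3 _; rewrite ler_wpM2l// mulr_ge0 ?sqr_ge0.
exact: (energy_estimate hnu hnuh hmu e h1 h2' r2).
Qed.

(** The product of [M], the bound [Cv] on the middle argument of [bform], the factor sqrt(CI H /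
    nuh) from the interpolated norm of the first argument and the factor sqrt(1 / nuh) from the
    gradient of the third. *)
Definition contraction_rate := Num.sqrt (M ^+ 2 * C ^+ 2 * (CI * H) / nuh ^+ 2).
Local Notation q := contraction_rate.

Lemma contraction_rate_lt1 : q < 1.
Proof.
have h : M ^+ 2 * C ^+ 2 * (CI * H) / nuh ^+ 2 < 1.
  rewrite ltr_pdivrMr ?exprn_gt0// mul1r.
  have s27 : 0 < Num.sqrt 27 :> R by rewrite sqrtr_gt0.
  have s2 : Num.sqrt 2 < Num.sqrt 27 :> R by rewrite ltr_sqrt// ltr_nat.
  have n2 : 0 < nuh ^+ 2 by rewrite exprn_gt0.
  rewrite -(ltr_pM2l s27); apply: le_lt_trans (_ : Num.sqrt 2 * nuh ^+ 2 < _).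
    by apply: le_trans hHsmall; rewrite le_eqVlt; apply/orP; left; apply/eqP; ring.
  by rewrite ltr_pM2r.
by rewrite /q -[X in _ < X]sqrtr1 ltr_sqrt.
Qed.

(** The lower bound on [mu] resolves the minimum in the coercivity inequality as
    [nuh / (2 * CI ^+ 2 * H ^+ 2)], which are exactly the weights of [amgm_weighted] at [CI * H]. *)
Lemma L2norm_norm_grad_energy w : V w -> L w * N w <= CI * H / nuh * E w ^+ 2.
Proof.
move=> Vw; have Xw := spaceV_X Vw.
have s0 : 0 < CI * H by rewrite mulr_gt0.
apply: le_trans (amgm_weighted (L w) (N w) hnuh s0) _.
apply: ler_wpM2l; first by rewrite divr_ge0 ?(ltW s0) ?(ltW hnuh).
rewrite (sqr_energy Vw); have := hIcoer Xw.
rewrite (_ : Num.min _ _ = nuh / (2 * (CI * H) ^+ 2)); first exact.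
by rewrite (min_r hmularge) exprMn -!mulrA.
Qed.

Lemma bform_contraction w v e : V w -> V v -> V e -> N v <= C ->
  `|bform Om w v e| <= q * E w * E e.
Proof.
move=> Vw Vv Ve vC; have [Xw Xv Xe] := And3 (spaceV_X Vw) (spaceV_X Vv) (spaceV_X Ve).
have LN0 : 0 <= L w * N w by rewrite mulr_ge0 ?L2norm_ge0 ?norm_grad_ge0.
apply: le_trans (bform_interpolation_bound oOm hM Xw Xv Xe) _.
have h1 := L2norm_norm_grad_energy Vw; have h2 := norm_grad_energy Ve.
have E0 z : 0 <= E z by exact: semi_norm_ge0.
have s : Num.sqrt (L w * N w) <= Num.sqrt (CI * H / nuh) * E w.
  have c0 : 0 <= CI * H / nuh.
    by rewrite divr_ge0 ?mulr_ge0 ?(ltW hCI) ?(ltW hH) ?(ltW hnuh).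
  have <- : Num.sqrt (CI * H / nuh * E w ^+ 2) = Num.sqrt (CI * H / nuh) * E w.
    by rewrite sqrtrM// sqrtr_sqr ger0_norm.
  exact: ler_wsqrtr.
apply: (@le_trans _ _ (`|M| * (Num.sqrt (CI * H / nuh) * E w) * C *
   (Num.sqrt nuh^-1 * E e))).
  exact: (prod4_le (normr_ge0 M) (sqrtr_ge0 _) (norm_grad_ge0 Om v) (norm_grad_ge0 Om e) s vC h2).
have -> : q = `|M| * C * Num.sqrt (CI * H / nuh) * Num.sqrt nuh^-1.
  have C0 := Cv_ge0.
  rewrite -[C in RHS](ger0_norm C0) -normrM -sqrtr_sqr -!sqrtrM ?sqr_ge0//; last first.
    by rewrite mulr_ge0 ?sqr_ge0// divr_ge0 ?mulr_ge0 ?(ltW hCI) ?(ltW hH) ?(ltW hnuh).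
  by rewrite /q; congr Num.sqrt; field; rewrite gt_eqF.
by rewrite le_eqVlt; apply/orP; left; apply/eqP; ring.
Qed.

Lemma CDA_exists : exists v, CDA_solution Om nuh mu I f u v.
Proof.
have [K2 FK] := load_bound.
have E0 z : 0 <= E z by exact: semi_norm_ge0.
have c0 : 0 <= Num.sqrt nuh^-1 by exact: sqrtr_ge0.
suff [v Vv Hv] : exists2 v, V v & forall x, V x -> energy v x + bform Om v v x = load x.
  by exists v; apply/CDA_solutionP.
apply: (@picard_fixpoint _ _ V energy Vlin energy_semi_inner energy_complete (bform Om)
  (`|M| * Num.sqrt nuh^-1 ^+ 3) K2 q load (fun v => N v <= C)).
- move=> v w /spaceV_X Xv /spaceV_X Xw k x y /spaceV_X Xx /spaceV_X Xy.
  exact: (bform_lin1 oOm hM Xv Xw).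
- move=> v w /spaceV_X Xv /spaceV_X Xw k x y /spaceV_X Xx /spaceV_X Xy.
  exact: (bform_lin2 oOm hM Xv Xw).
- move=> v w /spaceV_X Xv /spaceV_X Xw k x y /spaceV_X Xx /spaceV_X Xy.
  exact: (bform_lin3 oOm hM Xv Xw).
- move=> x v w Vx Vv Vw.
  apply: le_trans (bform_bound oOm hM (spaceV_X Vx) (spaceV_X Vv) (spaceV_X Vw)) _.
  have := norm_grad_energy Vx; have := norm_grad_energy Vv; have := norm_grad_energy Vw.
  have := norm_grad_ge0 Om x; have := norm_grad_ge0 Om v; have := norm_grad_ge0 Om w.
  have := E0 x; have := E0 v; have := E0 w.
  exact: (prod3_le (normr_ge0 M) c0).
- by move=> v w Vv /spaceV_X Xw; exact: (bform_skew oOm hM).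
- exact: load_lin.
- exact: FK.
- exact: sqrtr_ge0.
- exact: contraction_rate_lt1.
- by move=> v0 v Vv0 Vv; exact: a_priori.
- by move=> w v e Vw Vv Ve; exact: bform_contraction.
Qed.

Lemma CDA_bound v : CDA_solution Om nuh mu I f u v -> N v <= C.
Proof. by move=> /CDA_solutionP[Vv Hv]; exact: (a_priori Vv Vv Hv). Qed.

(** The Picard estimate for two solutions gives their difference zero energy, hence zero gradient
    norm. The Poincaré inequality then gives zero L^2 norm, which yields equality almost
    everywhere. *)
Lemma CDA_unique v1 v2 : CDA_solution Om nuh mu I f u v1 ->
  CDA_solution Om nuh mu I f u v2 -> ae_eq lam Om v1 v2.
Proof.
move=> s1 s2; have b2 := CDA_bound s2.
move: s1 s2 => /CDA_solutionP[V1 H1] /CDA_solutionP[V2 H2].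
have Vw := linear_setB Vlin V1 V2.
have [X1 X2 Xw] := And3 (spaceV_X V1) (spaceV_X V2) (spaceV_X Vw).
have : E (v1 - v2) ^+ 2 = - bform Om (v1 - v2) v2 (v1 - v2).
  rewrite (sqr_semi_norm energy_semi_inner Vw).
  rewrite (semi_innerBl Vlin energy_semi_inner V1 V2 Vw).
  have := H1 _ Vw; have := H2 _ Vw.
  have := bform_skew oOm hM V1 Xw.
  have := linear_onB Xlin (bform_lin2 oOm hM X1 Xw) X1 X2.
  have := linear_onB Xlin (bform_lin1 oOm hM X2 Xw) X1 X2.
  move: (bform Om) energy load => b en ld.
  by move=> /= -> -> ; lra.
have := bform_contraction Vw V2 Vw b2.
have := contraction_rate_lt1; have E0 : 0 <= E (v1 - v2) by exact: semi_norm_ge0.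
move=> q1 h e.
have Ew : E (v1 - v2) = 0.
  apply/eqP; rewrite -sqrf_eq0 eq_le sqr_ge0 andbT.
  have : E (v1 - v2) ^+ 2 <= q * E (v1 - v2) ^+ 2.
    by rewrite {1}e expr2 mulrA; apply: le_trans h; rewrite -normrN ler_norm.
  by have := sqr_ge0 (E (v1 - v2)); nra.
have Nw : N (v1 - v2) = 0.
  by apply/eqP; rewrite eq_le norm_grad_ge0 andbT; have := norm_grad_energy Vw;
    rewrite Ew mulr0.
have LFw := spaceX_L2 Xw.
have Lw : ip Om (v1 - v2) (v1 - v2) = 0.
  rewrite -(sqr_L2norm LFw); apply/eqP; rewrite sqrf_eq0 eq_le L2norm_ge0 andbT.
  by have := hCP Xw; rewrite Nw mulr0.
apply: filterS (ip_eq0_ae oOm LFw Lw) => x h0 Dx; apply/eqP; rewrite -subr_eq0; apply/eqP.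
exact: h0.
Qed.

End energy.

Theorem theorem3p1 (R : realType) (d : nat) (Om : set 'rV[R]_d)
  (M CP CI H nu nuh mu : R)
  (f : ('rV[R]_d -> 'rV[R]_d) -> R)
  (I : ('rV[R]_d -> 'rV[R]_d) -> 'rV[R]_d -> 'rV[R]_d)
  (u : 'rV[R]_d -> 'rV[R]_d)
  (hd : d = 2%N \/ d = 3%N)
  (hOm : admissible_domain Om)
  (hM : trilinear_bounds Om M)
  (hCP : poincare_constant Om CP)
  (hf : dualX Om f)
  (hnu : 0 < nu) (hnuh : 0 < nuh) (hmu : 0 < mu) (hH : 0 < H) (hCI : 0 < CI)
  (hI : interpolation_operator Om I H CI)
  (hIcoer : interpolation_coercivity Om I H CI nuh mu)
  (hu : NSE_weak_solution Om nu f u)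
  (* H <= sqrt 2 nuh^2 / (sqrt 27 CI M^2 Cv^2), cleared of its denominator so
     that a vanishing denominator means no restriction on H *)
  (hHsmall : H * (Num.sqrt 27 * CI * M ^+ 2 * Cv Om nu nuh mu CP CI f ^+ 2)
             <= Num.sqrt 2 * nuh ^+ 2)
  (hmularge : nuh / (2 * CI ^+ 2 * H ^+ 2) <= mu) :
  (exists v, CDA_solution Om nuh mu I f u v) /\
  (forall v1 v2, CDA_solution Om nuh mu I f u v1 ->
     CDA_solution Om nuh mu I f u v2 ->
     ae_eq (lebesgue_row R d) Om v1 v2) /\
  (forall v, CDA_solution Om nuh mu I f u v ->
     norm_grad Om v <= Cv Om nu nuh mu CP CI f).
Proof.
have [oOm _ _ _] := hOm.
split; first exact: (CDA_exists oOm hM hCP hf hnu hnuh hmu hH hCI hI hIcoer hu).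
split; first exact: (CDA_unique oOm hM hCP hf hnu hnuh hmu hH hCI hI hIcoer hu).
exact: (CDA_bound oOm hM hCP hf hnu hnuh hmu hCI hI hu).
Qed.
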